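(* For $k\in\mathbb{N}$, $k>1$, and $\alpha\in[0,2)$, let $\gamma^k_{\alpha,0}$ be the $k$-th iteration of the circular solution $\gamma_{\alpha,0}$ of the generalised Kepler problem. Then: (1) for every fixed $k>1$, $i_{\mathrm{Morse}}(\gamma^k_{\alpha,0})$ is a piecewise constant and non-increasing function of $\alpha\in[0,2)$; (2) for every fixed $k>1$, $i_{\mathrm{Morse}}(\gamma^k_{\alpha,0})=0$ for all $\alpha\in\left(2-\frac1{k^2},2\right)$; (3) for every fixed $\alpha\in[0,2)$, $i_{\mathrm{Morse}}(\gamma^k_{\alpha,0})\to+\infty$ as $k\to+\infty$.
   Context: Generalised Kepler problem: fix a constant $\mu>0$ and let $U:\mathbb{R}^2\setminus\{0\}\to\mathbb{R}$ be $U(x)=\mu/|x|^{\alpha}$ if $\alpha\in(0,2)$ and $U(x)=-\mu\log|x|$ if $\alpha=0$. The equation of motion is $\ddot x=\nabla U(x)$. $\gamma_{\alpha,0}$ denotes the solution describing a circle centred at the origin at constant angular speed $1$ (minimal period $2\pi$). Its $k$-th iteration $\gamma^k_{\alpha,0}$ is the same solution traversed $k$ times, viewed as a $2k\pi$-periodic loop, i.e. as a critical point of the action functional $\mathbb{A}_k(\gamma)=\int_0^{2k\pi}\big(\frac12|\dot\gamma|^2+U(\gamma)\big)dt$ on $W^{1,2}(\mathbb{R}/2k\pi\mathbb{Z},\mathbb{R}^2\setminus\{0\})$. The Morse index is the maximal dimension of a subspace of $W^{1,2}(\mathbb{R}/2k\pi\mathbb{Z},\mathbb{R}^2)$ on which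 the second variation of $\mathbb{A}_k$ at $\gamma^k_{\alpha,0}$ is negative definite. *)

(* Defs.v *)
From HB Require Import structures.
From mathcomp Require Import all_boot all_order all_algebra.
From mathcomp Require Import all_classical all_reals all_analysis.

Set Implicit Arguments.
Unset Strict Implicit.
Unset Printing Implicit Defensive.

Import Order.TTheory GRing.Theory Num.Theory.
Import numFieldNormedType.Exports.

Local Open Scope classical_set_scope.
Local Open Scope ring_scope.

Section Kepler.
Context {R : realType}.
Implicit Types (mu alpha T : R) (gamma xi : R -> R * R).

(* The library norm on R * R is the sup norm, hence an explicit Euclidean norm. *)
Definition enorm (p : R * R) : R := Num.sqrt (p.1 ^+ 2 + p.2 ^+ 2).

(* The value at the origin is irrelevant: U is only used on R^2 \ {0}. *)
Definition potential mu alpha (p : R * R) : R :=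
  if alpha == 0 then - mu * ln (enorm p) else mu / enorm p `^ alpha.

Definition grad (U : R * R -> R) (p : R * R) : R * R :=
  ('D_((1, 0) : R * R) U p, 'D_((0, 1) : R * R) U p).

Definition kepler_solution mu alpha gamma : Prop :=
  forall t : R,
    [/\ gamma t != 0, derivable gamma t 1, derivable (derive1 gamma) t 1 &
        derive1n 2 gamma t = grad (potential mu alpha) (gamma t)].

(* The phase and the orientation are left free; the radius is forced by the
   equation of motion. *)
Definition circular_solution mu alpha gamma : Prop :=
  kepler_solution mu alpha gamma /\
  exists r omega theta : R, [/\ 0 < r, `|omega| = 1 &
    forall t, gamma t =
      (r * cos (omega * t + theta), r * sin (omega * t + theta))].

(* g is, on [0, T], an L^2 weak derivative of x: in dimension one this means
   that x is the primitive of g.  Sobolev functions are thereby identified with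
   their absolutely continuous representatives. *)
Definition is_wderiv T (x g : R -> R) : Prop :=
  [/\ measurable_fun `[0, T] g,
      lebesgue_measure.-integrable `[0, T] (fun t => (g t ^+ 2)%:E) &
      forall t, 0 <= t <= T ->
        x t = x 0 + \int[lebesgue_measure]_(s in `[0, t]) g s].

(* The space W^{1,2}(R / TZ, R^2), as T-periodic functions on R. *)
Definition W12 T gamma : Prop :=
  [/\ forall t, gamma (t + T) = gamma t,
      exists g, is_wderiv T (fst \o gamma) g &
      exists g, is_wderiv T (snd \o gamma) g].

(* A weak derivative, unique up to a null set of [0, T] when one exists. *)
Definition wderiv T (x : R -> R) : R -> R :=
  xget (fun=> 0) [set g | is_wderiv T x g].

Definition action mu alpha T gamma : R :=
  \int[lebesgue_measure]_(t in `[0, T])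
    ((wderiv T (fst \o gamma) t ^+ 2 + wderiv T (snd \o gamma) t ^+ 2) / 2
     + potential mu alpha (gamma t)).

(* The quadratic form xi |-> d^2/ds^2 A(gamma + s xi) at s = 0. *)
Definition second_variation mu alpha T gamma xi : R :=
  derive1n 2 (fun s : R => action mu alpha T (fun t => gamma t + s *: xi t)) 0.

(* Q is negative definite on some n-dimensional subspace of W12 T, given by a
   basis e. *)
Definition neg_def_dim T (Q : (R -> R * R) -> R) (n : nat) : Prop :=
  exists e : 'I_n -> R -> R * R,
    [/\ forall i, W12 T (e i),
        forall c : 'I_n -> R,
          (forall t, \sum_(i < n) c i *: e i t = 0) -> forall i, c i = 0 &
        forall c : 'I_n -> R, (exists i, c i != 0) ->
          Q (fun t => \sum_(i < n) c i *: e i t) < 0].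

(* n is the Morse index of the k-th iterate of the 2pi-periodic solution gamma,
   i.e. of gamma seen as a loop of period 2 k pi. *)
Definition is_morse_index mu alpha (k : nat) gamma (n : nat) : Prop :=
  let T := 2 * k%:R * pi in
  let Q := second_variation mu alpha T gamma in
  neg_def_dim T Q n /\ forall m, neg_def_dim T Q m -> (m <= n)%N.

(* Constant on each open interval of a finite subdivision
   a = s_0 < s_1 < ... < s_N = b; the value at a subdivision point is free. *)
Definition piecewise_constant (a b : R) (f : R -> nat) : Prop :=
  exists s : seq R, [/\ path <%R a s, last a s = b &
    forall i, (i < size s)%N ->
      forall x y, nth a (a :: s) i < x < nth a s i ->
                  nth a (a :: s) i < y < nth a s i -> f x = f y].

End Kepler.

(* Main.v *)
(** In the rotating frame of the circle, with radial and tangential components u, v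
    of the variation, the second variation is the integral of
    u'^2 + (v' + 2 omega u)^2 - (2 - alpha) u^2 over a period T = 2 k pi.  On the
    modes u = cos (j t / k), sin (j t / k) with v' = - 2 omega u it is negative exactly
    when j^2 < (2 - alpha) k^2, so that the index is 2M, with M the number of such
    positive j, and the three claims are read off this formula.

    The upper bound avoids Fourier series.  Given 2M + 1 variations, consider their
    radial components together with the constant 1 at 2M + 2 equally spaced points of
    the circle: translating by one step permutes the points by an odd cycle, so the
    determinant of the values vanishes at some translate.  A combination u + c then
    vanishes at all these points, the Dirichlet inequality on each arc gives
    int u'^2 >= ((M + 1) / k)^2 int (u + c)^2, and the second variation is nonnegative
    on this combination. *)
Require Import Defs.
From mathcomp Require Import all_boot all_order all_algebra fingroup perm.
From mathcomp Require Import all_classical all_reals all_analysis.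
From mathcomp Require Import measurable_realfun ring lra.
Import Order.TTheory GRing.Theory Num.Theory.
Import numFieldNormedType.Exports.
Local Open Scope classical_set_scope.
Local Open Scope ring_scope.

Set Implicit Arguments.
Unset Strict Implicit.
Unset Printing Implicit Defensive.

(** [second_variation] is a genuine second derivative of the action along W^{1,2} variations, and
    [wderiv] is only a chosen representative; hence the preliminaries on absolutely continuous
    functions and on differentiation under the integral. The equation of motion enters through a
    single number: on the circle, the derivative of the potential with respect to the squared
    distance is -1/2. After that mu and the radius disappear, and the logarithm behaves as the case
    alpha = 0 of the power law. Only positive j count because v' = - 2 omega u has no periodic
    solution when u is a nonzero constant: the square then contributes at least 4 u^2 on average,
    which outweighs (2 - alpha) u^2. The same obstruction pays for the shift by c in the upper
    bound. The counts match exactly: 2M + 1 variations and the constant make an even number of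
    functions, so the cycle is odd, and the 2M + 2 zeros cut the period 2 k pi into arcs of length k
    pi / (M + 1), whose lowest Dirichlet frequency (M + 1) / k is that of the first mode that is not
    negative. *)

Section Integrals.
Context {R : realType}.
Notation mu := (@lebesgue_measure R).
Implicit Types (a b c t : R) (f g x y : R -> R).

(** * Integrable and square-integrable functions on a segment *)

Definition L1 a b f : Prop := mu.-integrable `[a, b] (EFin \o f).

Definition Int a b f : R := \int[mu]_(t in `[a, b]) f t.

Lemma measure_itv_lty a b : (mu `[a, b] < +oo)%E.
Proof. by apply: compact_finite_measure; exact: segment_compact. Qed.

Lemma L1_sub a b c d f : a <= c -> d <= b -> L1 a b f -> L1 c d f.
Proof.
move=> ac db; apply: integrableS => // t /=; rewrite !in_itv/= => /andP[ct td].
by rewrite (le_trans ac)// (le_trans td).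
Qed.

Lemma L1_meas a b f : L1 a b f -> measurable_fun `[a, b] f.
Proof. by move=> /(measurable_int mu)/measurable_EFinP. Qed.

Lemma L1D a b f g : L1 a b f -> L1 a b g -> L1 a b (fun t => f t + g t).
Proof. by move=> lf lg; rewrite /L1; apply: (integrableD _ lf lg). Qed.

Lemma L1N a b f : L1 a b f -> L1 a b (fun t => - f t).
Proof. by move=> lf; rewrite /L1; apply: (integrableN lf). Qed.

Lemma L1B a b f g : L1 a b f -> L1 a b g -> L1 a b (fun t => f t - g t).
Proof. by move=> lf lg; apply: L1D => //; exact: L1N. Qed.

Lemma L1Z a b k f : L1 a b f -> L1 a b (fun t => k * f t).
Proof. by move=> lf; rewrite /L1; apply: (integrableZl _ k lf). Qed.

Lemma L1_norm a b f : L1 a b f -> L1 a b (fun t => `|f t|).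
Proof. by move=> lf; apply: (integrable_norm lf). Qed.

Lemma L1_eq a b f g : (forall t, a <= t <= b -> f t = g t) -> L1 a b f -> L1 a b g.
Proof.
move=> fg; apply: eq_integrable => // t; rewrite inE/= in_itv/= => abt.
by rewrite /= fg.
Qed.

Lemma L1_le a b f g : measurable_fun `[a, b] f ->
  (forall t, a <= t <= b -> `|f t| <= g t) -> L1 a b g -> L1 a b f.
Proof.
move=> mf fg; apply: le_integrable => //; first exact/measurable_EFinP.
move=> t /=; rewrite in_itv/= lee_fin => /fg /le_trans; apply; exact: ler_norm.
Qed.

Lemma L1_cst a b k : L1 a b (cst k).
Proof.
apply: measurable_bounded_integrable => //; first exact: measure_itv_lty.
exact: bounded_cst.
Qed.

Definition cont a b f : Prop := {within `[a, b], continuous f}.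

Lemma continuous_cont a b f : continuous f -> cont a b f.
Proof. by move=> cf; apply: continuous_subspaceT. Qed.

Lemma cont_meas a b f : cont a b f -> measurable_fun `[a, b] f.
Proof. by move=> cf; apply: subspace_continuous_measurable_fun. Qed.

(** The class of multipliers: closed under products, containing the continuous functions, and
    preserving both L1 and L2. *)
Definition bmeas a b f : Prop :=
  measurable_fun `[a, b] f /\ exists M, forall t, a <= t <= b -> `|f t| <= M.

Lemma cont_bmeas a b f : cont a b f -> bmeas a b f.
Proof.
move=> cf; split; first exact: cont_meas.
have /compact_bounded[M [_ HM]] := continuous_compact cf (@segment_compact _ a b).
exists (M + 1) => t abt; apply: HM; first by rewrite ltrDl.
by exists t.
Qed.

Lemma bmeas_L1 a b f : bmeas a b f -> L1 a b f.
Proof.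
move=> [mf [M fM]]; apply: L1_le mf fM _; exact: L1_cst.
Qed.

Lemma bmeasD a b f g : bmeas a b f -> bmeas a b g ->
  bmeas a b (fun t => f t + g t).
Proof.
move=> [mf [M fM]] [mg [N gN]]; split; first exact: measurable_funD.
exists (M + N) => t abt; rewrite (le_trans (ler_normD _ _))//.
by rewrite lerD ?fM ?gN.
Qed.

Lemma bmeasM a b f g : bmeas a b f -> bmeas a b g ->
  bmeas a b (fun t => f t * g t).
Proof.
move=> [mf [M fM]] [mg [N gN]]; split; first exact: measurable_funM.
by exists (M * N) => t abt; rewrite normrM ler_pM ?fM ?gN.
Qed.

Lemma bmeas_cst a b k : bmeas a b (cst k).
Proof. by split; [exact: measurable_cst|exists `|k|]. Qed.

Lemma L1_bmeasM a b f g : bmeas a b f -> L1 a b g -> L1 a b (fun t => f t * g t).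
Proof.
move=> [mf [M fM]] lg; apply: (@L1_le _ _ _ (fun t => M * `|g t|)).
- by apply: measurable_funM => //; exact: L1_meas.
- by move=> t abt; rewrite normrM ler_wpM2r// fM.
- by apply: L1Z; exact: L1_norm.
Qed.

Lemma eq_Int a b f g : (forall t, a <= t <= b -> f t = g t) -> Int a b f = Int a b g.
Proof.
by move=> fg; apply: eq_Rintegral => t; rewrite inE/= in_itv/= => /fg.
Qed.

Lemma IntD a b f g : L1 a b f -> L1 a b g ->
  Int a b (fun t => f t + g t) = Int a b f + Int a b g.
Proof. by move=> lf lg; rewrite /Int RintegralD. Qed.

Lemma IntB a b f g : L1 a b f -> L1 a b g ->
  Int a b (fun t => f t - g t) = Int a b f - Int a b g.
Proof. by move=> lf lg; rewrite /Int RintegralB. Qed.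

Lemma IntZ a b k f : L1 a b f -> Int a b (fun t => k * f t) = k * Int a b f.
Proof. by move=> lf; rewrite /Int RintegralZl. Qed.

Lemma Int_aa a f : Int a a f = 0.
Proof. by rewrite /Int set_itv1 Rintegral_set1. Qed.

Lemma Int_cst a b k : a <= b -> Int a b (fun=> k) = k * (b - a).
Proof.
rewrite le_eqVlt => /predU1P[<-|ab]; first by rewrite Int_aa subrr mulr0.
by rewrite /Int Rintegral_cst//= lebesgue_measure_itv/= lte_fin ab.
Qed.

Lemma Int_ge0 a b f : (forall t, a <= t <= b -> 0 <= f t) -> 0 <= Int a b f.
Proof. by move=> f0; apply: Rintegral_ge0 => t /=; rewrite in_itv/= => /f0. Qed.

Lemma le_Int a b f g : L1 a b f -> L1 a b g ->
  (forall t, a <= t <= b -> f t <= g t) -> Int a b f <= Int a b g.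
Proof.
by move=> lf lg fg; apply: le_Rintegral => // t /=; rewrite in_itv/= => /fg.
Qed.

Lemma le_norm_Int a b f : L1 a b f -> `|Int a b f| <= Int a b (fun t => `|f t|).
Proof. by move=> lf; apply: le_normr_Rintegral. Qed.

Lemma Int_chasles a b c f : a <= b -> b <= c -> L1 a c f ->
  Int a c f = Int a b f + Int b c f.
Proof.
move=> ab bc lf; have := @Rintegral_itvB R f (BLeft a) (BRight c) b lf.
rewrite !bnd_simp => /(_ ab bc).
rewrite Rintegral_itv_obnd_cbnd; last first.
  apply: integrableS lf => // t /=; rewrite !in_itv/= => /andP[bt tc].
  by rewrite (le_trans ab (ltW bt)).
by rewrite /Int => <-; rewrite addrC subrK.
Qed.

(** The variance of f about its mean [m] is nonnegative; multiplying by b - a gives the claim. *)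
Lemma Int_cauchy a b f : a <= b -> L1 a b f -> L1 a b (fun t => f t ^+ 2) ->
  Int a b f ^+ 2 <= (b - a) * Int a b (fun t => f t ^+ 2).
Proof.
move=> ab lf lf2; move: (ab); rewrite le_eqVlt => /predU1P[<-|ltab].
  by rewrite !Int_aa expr0n mulr0.
have ba : 0 < b - a by rewrite subr_gt0.
pose m := Int a b f / (b - a).
have : 0 <= Int a b (fun t => (f t - m) ^+ 2).
  by apply: Int_ge0 => t _; exact: sqr_ge0.
have -> : Int a b (fun t => (f t - m) ^+ 2) =
    Int a b (fun t => (f t ^+ 2 - (2 * m) * f t) + m ^+ 2).
  by apply: eq_Int => t _; ring.
rewrite IntD; [|by apply: L1B => //; exact: L1Z|exact: L1_cst].
rewrite Int_cst// IntB//; last exact: L1Z.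
rewrite IntZ// /m.
have ba0 : b - a != 0 by rewrite gt_eqF.
rewrite (_ : _ - _ + _ = Int a b (fun t => f t ^+ 2) - Int a b f ^+ 2 / (b - a)).
  by rewrite subr_ge0 ler_pdivrMr// mulrC.
by field.
Qed.

Definition L2 a b f : Prop :=
  measurable_fun `[a, b] f /\ L1 a b (fun t => f t ^+ 2).

Lemma L2M a b f g : L2 a b f -> L2 a b g -> L1 a b (fun t => f t * g t).
Proof.
move=> [mf lf] [mg lg]; apply: L1_le (L1D lf lg); first exact: measurable_funM.
move=> t _; rewrite ler_norml; nra.
Qed.

Lemma L2_sqr a b f : L2 a b f -> L1 a b (fun t => f t ^+ 2).
Proof. by case. Qed.

Lemma bmeas_L2 a b f : bmeas a b f -> L2 a b f.
Proof. by move=> bf; split; [case: bf|apply: bmeas_L1; exact: bmeasM]. Qed.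

Lemma L2_L1 a b f : L2 a b f -> L1 a b f.
Proof.
move=> lf; apply: (@L1_eq _ _ (fun t => 1 * f t)) => [t _|]; first exact: mul1r.
by apply: L2M => //; apply: bmeas_L2; exact: bmeas_cst.
Qed.

Lemma L2D a b f g : L2 a b f -> L2 a b g -> L2 a b (fun t => f t + g t).
Proof.
move=> lf lg; have lfg := L2M lf lg; case: lf lg => [mf lf] [mg lg].
split; first exact: measurable_funD.
apply: (@L1_eq _ _ (fun t => (f t ^+ 2 + 2 * (f t * g t)) + g t ^+ 2)).
  by move=> t _; ring.
by apply: L1D => //; apply: L1D => //; exact: L1Z.
Qed.

Lemma L2_bmeasM a b f g : bmeas a b f -> L2 a b g -> L2 a b (fun t => f t * g t).
Proof.
move=> bf [mg lg]; split; first by apply: measurable_funM => //; case: bf.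
apply: (@L1_eq _ _ (fun t => (f t * f t) * g t ^+ 2)) => [t _|]; first ring.
by apply: L1_bmeasM => //; exact: bmeasM.
Qed.

Lemma L2Z a b k f : L2 a b f -> L2 a b (fun t => k * f t).
Proof. by move=> lf; apply: L2_bmeasM => //; exact: bmeas_cst. Qed.

End Integrals.

(** * Absolutely continuous functions and the product rule *)

Section Primitives.
Context {R : realType}.
Notation mu := (@lebesgue_measure R).
Implicit Types (a b c s t : R) (f g h x y : R -> R).

(** Absolute continuity of x with derivative g. Asking only for L1 separates this calculus from the
    square integrability in [is_wderiv]. *)
Definition prim a b x g : Prop :=
  L1 a b g /\ forall t, a <= t <= b -> x t = x a + Int a t g.

Lemma prim_incr a b x g s t : prim a b x g -> a <= s -> s <= t -> t <= b ->
  x t - x s = Int s t g.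
Proof.
move=> [lg xE] as_ st tb; rewrite (xE t) ?tb ?andbT ?(le_trans as_)//.
rewrite (xE s) ?as_ ?(le_trans st)// (@Int_chasles _ a s t)//; last first.
  exact: L1_sub lg.
ring.
Qed.

Lemma prim_sub a b c d x g : a <= c -> d <= b -> prim a b x g -> prim c d x g.
Proof.
move=> ac db pxg; split; first by apply: L1_sub (pxg.1).
move=> t /andP[ct td]; rewrite -(prim_incr pxg)//; first ring.
exact: le_trans td db.
Qed.

Lemma eq_cont a b f g : (forall t, a <= t <= b -> f t = g t) ->
  cont a b f -> cont a b g.
Proof.
move=> fg; rewrite /cont; apply: subspace_eq_continuous => t.
by rewrite inE/= in_itv/= => /fg.
Qed.

Lemma contD a b f g : cont a b f -> cont a b g -> cont a b (fun t => f t + g t).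
Proof. by move=> cf cg t; apply: continuousD; [exact: cf|exact: cg]. Qed.

Lemma contM a b f g : cont a b f -> cont a b g -> cont a b (fun t => f t * g t).
Proof. by move=> cf cg t; apply: continuousM; [exact: cf|exact: cg]. Qed.

Lemma cont_cst a b k : cont a b (cst k).
Proof. by apply: continuous_cont => t; exact: cvg_cst. Qed.

Lemma prim_cont a b x g : prim a b x g -> cont a b x.
Proof.
move=> [lg xE]; have [ab|ba] := leP a b; last first.
  by rewrite /cont set_itv_ge ?bnd_simp -?ltNge//; exact: continuous_subspace0.
apply: (@eq_cont _ _ (fun t => x a + Int a t g)) => [t /xE//|].
by apply: contD; [exact: cont_cst|exact: parameterized_integral_continuous].
Qed.

Lemma primD a b x g y h : prim a b x g -> prim a b y h ->
  prim a b (fun t => x t + y t) (fun t => g t + h t).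
Proof.
move=> [lg xE] [lh yE]; split; first exact: L1D.
move=> t /[dup] abt /andP[at_ tb]; rewrite xE// yE// IntD; first ring.
  exact: L1_sub lg.
exact: L1_sub lh.
Qed.

Lemma primZ a b k x g : prim a b x g ->
  prim a b (fun t => k * x t) (fun t => k * g t).
Proof.
move=> [lg xE]; split; first exact: L1Z.
move=> t /[dup] abt /andP[at_ tb]; rewrite xE// IntZ; first ring.
exact: L1_sub lg.
Qed.

Lemma prim_cst a b k : prim a b (cst k) (cst 0).
Proof.
split; first exact: L1_cst.
by move=> t /andP[at_ _]; rewrite Int_cst// mul0r addr0.
Qed.

Lemma eq_prim a b x g y h : (forall t, a <= t <= b -> x t = y t) ->
  (forall t, a <= t <= b -> g t = h t) -> prim a b x g -> prim a b y h.
Proof.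
move=> xy gh [lg xE]; split; first exact: L1_eq lg.
move=> t /andP[at_ tb]; rewrite -!xy ?lexx ?at_ ?tb//=; last exact: le_trans tb.
rewrite xE ?at_//; congr (_ + _); apply: eq_Int => s /andP[as_ st].
by rewrite gh// as_ (le_trans st).
Qed.

Lemma ler_half_pow (c d : R) : (forall n, c <= d / 2 ^+ n) -> c <= 0.
Proof.
move=> cd; rewrite leNgt; apply/negP => c0.
have d0 : 0 < d by have := cd 0%N; rewrite expr0 divr1; exact: lt_le_trans.
pose n := (Num.trunc (d / c)).+1.
have dcn : d / c < n%:R by rewrite truncnS_gt.
have : c * 2 ^+ n <= d by rewrite -ler_pdivlMr ?exprn_gt0.
apply/negP; rewrite -ltNge; apply: lt_trans (_ : n%:R * c < _).
  by rewrite -ltr_pdivrMr.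
by rewrite mulrC ltr_pM2l// -natrX ltr_nat ltn_expl.
Qed.

(* Bisecting [s, t] so as to halve the integral of f each time improves the bound on
   the increment to 2 ^- n times the square of the integral. *)
Lemma sqr_incr_cst a b f x : L1 a b f -> (forall t, a <= t <= b -> 0 <= f t) ->
  (forall s t, a <= s -> s <= t -> t <= b -> `|x t - x s| <= Int s t f ^+ 2) ->
  forall s t, a <= s -> s <= t -> t <= b -> x t = x s.
Proof.
move=> lf f0 xf s t as_ st tb.
apply/eqP; rewrite -subr_eq0 -normr_le0.
apply: (@ler_half_pow _ (Int s t f ^+ 2)) => n.
elim: n s t as_ st tb => [|n IHn] s t as_ st tb.
  by rewrite expr0 divr1; exact: xf.
have lst : L1 s t f by exact: L1_sub lf.
have Ist0 : 0 <= Int s t f.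
  apply: Int_ge0 => r /andP[sr rt]; apply: f0.
  by rewrite (le_trans as_)// (le_trans rt).
have [r] : exists2 r, r \in `[s, t] & Int s r f = Int s t f / 2.
  apply: IVT => //; first exact: parameterized_integral_continuous.
  by rewrite Int_aa minEle maxEle Ist0; apply/andP; split; lra.
rewrite in_itv/= => /andP[sr rt] rE.
have Irt : Int r t f = Int s t f / 2.
  by have := Int_chasles sr rt lst; rewrite rE; lra.
have h1 := IHn s r as_ sr (le_trans rt tb).
have h2 := IHn r t (le_trans as_ sr) rt tb.
rewrite -(subrK (x r) (x t)) -addrA (le_trans (ler_normD _ _))//.
apply: le_trans (lerD h2 h1) _.
rewrite rE Irt (exprS 2 n); set u := Int s t f; set p := 2 ^+ n.
have p0 : p != 0 by rewrite /p expf_eq0 pnatr_eq0 andbF.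
by rewrite le_eqVlt; apply/orP; left; apply/eqP; field.
Qed.

(** The defect [D] between the product and the integral of its expected derivative has increments
    that are quadratically small in the integral of |g| + |h|, so [sqr_incr_cst] makes it constant.
    No pointwise differentiability is involved. *)
Lemma primM a b x g y h : prim a b x g -> prim a b y h ->
  prim a b (fun t => x t * y t) (fun t => g t * y t + x t * h t).
Proof.
move=> pxg pyh; have [[lg _] [lh _]] := (pxg, pyh).
have bx := cont_bmeas (prim_cont pxg); have by_ := cont_bmeas (prim_cont pyh).
pose k t := g t * y t + x t * h t.
have lk : L1 a b k.
  apply: L1D; last exact: L1_bmeasM.
  by apply: (@L1_eq _ _ _ (fun t => y t * g t)) => [t _|];
    [rewrite mulrC|exact: L1_bmeasM].
split=> // t0 /andP[at0 t0b].
pose G t := `|g t| + `|h t|.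
have lG : L1 a b G by apply: L1D; exact: L1_norm.
have G0 t : 0 <= G t by rewrite addr_ge0.
pose D t := x t * y t - Int a t k.
suff : D t0 = D a by rewrite /D Int_aa subr0 => <-; rewrite subrK.
apply: (@sqr_incr_cst a b G) => // s t as_ st tb.
have sub f : L1 a b f -> L1 s t f by move=> lf; exact: L1_sub lf.
have Gmono u v f : s <= u -> u <= v -> v <= t -> L1 a b f ->
    (forall r, `|f r| <= G r) -> `|Int u v f| <= Int s t G.
  move=> su uv vt lf fG.
  have uvs f' : L1 a b f' -> L1 u v f'.
    by apply: L1_sub; [exact: le_trans su|exact: le_trans tb].
  apply: le_trans (le_norm_Int (uvs _ lf)) _.
  apply: (@le_trans _ _ (Int u v G)).
    by apply: le_Int => //; [exact/uvs/L1_norm|exact: uvs].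
  rewrite (@Int_chasles _ s u t)//; [|exact: le_trans vt|exact: sub].
  rewrite (@Int_chasles _ u v t)//; last first.
    by apply: L1_sub lG => //; exact: le_trans su.
  by rewrite addrCA lerDl addr_ge0// Int_ge0.
(* Freezing y at the right end and x at the left end leaves, under the integral, only increments of
   x and y as factors of h and g. Each increment is at most the integral of [G] over [s, t], whence
   the square. *)
have -> : D t - D s = (x t - x s) * y t + x s * (y t - y s) - Int s t k.
  rewrite /D (@Int_chasles _ a s t)//; last exact: L1_sub lk.
  ring.
rewrite (prim_incr pxg)// (prim_incr pyh)// mulrC -!IntZ; try exact: sub.
rewrite -IntD; try exact/sub/L1Z.
rewrite -IntB; [|by apply/sub/L1D; exact: L1Z|exact: sub].
have lE : L1 s t (fun r => y t * g r + x s * h r - k r).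
  by apply/sub/L1B => //; apply: L1D; exact: L1Z.
apply: le_trans (le_norm_Int lE) _.
rewrite expr2 -IntZ; last exact: sub.
apply: le_Int; [exact: L1_norm|exact/L1Z/sub|].
move=> r /andP[sr rt].
have -> : y t * g r + x s * h r - k r = g r * (y t - y r) - (x r - x s) * h r.
  by rewrite /k; ring.
apply: le_trans (ler_normB _ _) _.
have hx : `|x r - x s| <= Int s t G.
  rewrite (prim_incr pxg)//; last exact: le_trans tb.
  by apply: Gmono => // q; rewrite /G lerDl.
have hy : `|y t - y r| <= Int s t G.
  rewrite (prim_incr pyh)//; last exact: le_trans sr.
  by apply: Gmono => // q; rewrite /G lerDr.
rewrite [X in _ <= _ * X]/G [leRHS]mulrDr (mulrC _ `|g r|) !normrM.
by apply: lerD; [exact: ler_wpM2l|exact: ler_wpM2r].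
Qed.

Lemma C1_prim a b F f : (forall t, a <= t <= b -> is_derive t 1 F (f t)) ->
  cont a b f -> prim a b F f.
Proof.
move=> dF cf; split; first exact/bmeas_L1/cont_bmeas.
move=> t /andP[]; rewrite le_eqVlt => /predU1P[<- _|at_ tb].
  by rewrite Int_aa addr0.
have cF : cont a t F.
  apply: derivable_within_continuous => s; rewrite in_itv/= => /andP[as_ st].
  by have [] := dF s; rewrite ?as_ ?(le_trans st).
rewrite /Int /Rintegral (@continuous_FTC2 _ f F)//=.
- ring.
- apply: (@continuous_subspaceW _ _ _ `[a, b]) cf.
  move=> s /=; rewrite !in_itv/= => /andP[-> st]/=; exact: le_trans tb.
- split.
  + move=> s; rewrite in_itv/= => /andP[as_ st].
    by have [] := dF s; rewrite ?(ltW as_) ?(le_trans (ltW st)).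
  + by have /(continuous_within_itvP _ at_)[] := cF.
  + by have /(continuous_within_itvP _ at_)[] := cF.
- move=> s; rewrite in_itv/= => /andP[as_ st]; rewrite derive1E.
  have sab : a <= s <= b by rewrite (ltW as_) (le_trans (ltW st)).
  by have /@derive_val -> := dF s sab.
Qed.

End Primitives.

(** * Almost everywhere uniqueness of weak derivatives *)

Section WeakDerivatives.
Context {R : realType}.
Notation mu := (@lebesgue_measure R).
Implicit Types (a b c s t T : R) (f g h x y : R -> R).

Lemma is_wderivP T x g : is_wderiv T x g <-> L2 0 T g /\ prim 0 T x g.
Proof.
split=> [[mg ig xE]|[[mg ig] [_ xE]]]; last by [].
have l2 : L2 0 T g by [].
by split=> //; split=> //; exact: L2_L1.
Qed.

Lemma ae_neq c : {ae mu, forall t, t <> c}.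
Proof.
exists [set c]; split => //; first exact: lebesgue_measure_set1.
by move=> t /= /contrapT.
Qed.

(** By Lebesgue differentiation g is almost everywhere the derivative of its primitive, which
    vanishes around every interior point. The two endpoints are discarded as a null set. *)
Lemma Int0_ae0 T g : L1 0 T g -> (forall t, 0 <= t <= T -> Int 0 t g = 0) ->
  {ae mu, forall t, 0 <= t <= T -> g t = 0}.
Proof.
move=> lg g0.
pose k := g \_ `[0, T].
have lk b : mu.-integrable `[0, b] (EFin \o k).
  apply: (@integrableS _ _ _ _ setT) => //.
  by rewrite /k -restrict_EFin; exact/(integrable_mkcond _ _).1.
have := FTC1 lk (integrable_locally_restrict (measurable_itv _) lg).
move=> aek; have ne0 := ae_neq 0; have neT := ae_neq T.
have FF := ae_filter_ringOfSetsType mu.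
apply: filterS3 aek ne0 neT => t Hk t0 tT.
move=> /andP[]; rewrite le_eqVlt => /predU1P[/esym//|lt0].
rewrite le_eqVlt => /predU1P[//|ltT].
have [|_] := Hk _.
  by rewrite /= lte_fin.
rewrite /k patchE mem_set; last by rewrite /= in_itv/= !ltW.
move=> <-; rewrite derive1E.
rewrite (@near_eq_derive _ _ _ _ (cst 0)) ?derive_cst//.
near=> s.
have s0 : 0 < s by near: s; exact: lt_nbhsr.
have sT : s < T by near: s; exact: lt_nbhsl.
rewrite [RHS]/= -[RHS](g0 s) ?ltW//.
apply: eq_Rintegral => r; rewrite inE/= in_itv/= => /andP[r0 rs].
by rewrite patchE mem_set//= in_itv/= r0 (le_trans rs)// ltW.
Unshelve. all: by end_near. Qed.

Lemma prim_unique T x g h : prim 0 T x g -> prim 0 T x h ->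
  {ae mu, forall t, 0 <= t <= T -> g t = h t}.
Proof.
move=> [lg xg] [lh xh].
have := @Int0_ae0 T (fun t => g t - h t) (L1B lg lh) _.
have /[swap]/[apply] : forall t, 0 <= t <= T -> Int 0 t (fun t => g t - h t) = 0.
  move=> t /[dup] t0T /andP[t0 tT].
  rewrite IntB; [|exact: L1_sub lg|exact: L1_sub lh].
  by have := xg t t0T; rewrite xh// => /addrI ->; rewrite subrr.
apply: filterS; first exact: (ae_filter_ringOfSetsType mu).
by move=> t /[swap] t0T /(_ t0T)/eqP; rewrite subr_eq0 => /eqP.
Qed.

(** The choice hidden in [wderiv] is harmless: once some weak derivative is known, the chosen one
    can be exchanged for it under an integral. *)
Lemma wderivP T x g : is_wderiv T x g ->
  is_wderiv T x (wderiv T x) /\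
  {ae mu, forall t, 0 <= t <= T -> wderiv T x t = g t}.
Proof.
move=> xg; have xw : is_wderiv T x (wderiv T x).
  rewrite /wderiv; case: xgetP => [_ _//|/(_ g)]; exact.
split=> //; have [_ pg] := (is_wderivP _ _ _).1 xg.
by have [_ pw] := (is_wderivP _ _ _).1 xw; exact: prim_unique pw pg.
Qed.

Lemma ae_eq_Int a b f g : measurable_fun `[a, b] f -> measurable_fun `[a, b] g ->
  {ae mu, forall t, a <= t <= b -> f t = g t} -> Int a b f = Int a b g.
Proof.
move=> mf mg fg; congr fine; apply: ae_eq_integral => //.
- exact/measurable_EFinP.
- exact/measurable_EFinP.
- apply: filterS fg; first exact: (ae_filter_ringOfSetsType mu).
  by move=> t h /=; rewrite in_itv/= => /h ->.
Qed.

End WeakDerivatives.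

(** * Differentiating twice under the integral sign *)

Section SecondDerivative.
Context {R : realType}.
Notation mu := (@lebesgue_measure R).
Implicit Types (a s t T d K : R) (b c : R -> R).

Lemma is_derive_Int T d K (F F' : R -> R -> R) s :
  (forall r : R, `|r| < d -> bmeas 0 T (F r)) ->
  (forall r t : R, `|r| < d -> 0 <= t <= T -> is_derive r 1 (F ^~ t) (F' r t)) ->
  (forall r t : R, `|r| < d -> 0 <= t <= T -> `|F' r t| <= K) ->
  `|s| < d -> is_derive s 1 (fun r => Int 0 T (F r)) (Int 0 T (F' s)).
Proof.
move=> mF dF F'K sd.
have itvE (r : R) : `]- d, d[%classic r -> `|r| < d by rewrite /= in_itv/= ltr_norml.
have sI : `]- d, d[%classic s by rewrite /= in_itv/= -ltr_norml.
have K0 t : 0 <= t <= T -> 0 <= K.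
  by move=> /(F'K _ _ sd); exact: le_trans.
(* The absolute value keeps the dominating function nonnegative even when [0, T] is empty and the
   bounds say nothing about the sign of [K]. *)
pose G := fun _ : R => `|K|.
have p1E r t : `|r| < d -> 0 <= t <= T -> partial1of2 F r t = F' r t.
  move=> rd t0T; rewrite partial1of2E.
  by have /@derive_val := dF r t rd t0T.
have iF (r : R) : `]- d, d[%classic r -> mu.-integrable `[0, T] (EFin \o F r).
  by move=> /itvE/mF/bmeas_L1.
have dF1 (r t : R) : `]- d, d[%classic r -> `[0, T]%classic t -> derivable (F ^~ t) r 1.
  move=> /itvE rd; rewrite /= in_itv/= => t0T.
  by have /@ex_derive := dF r t rd t0T.
have G0 t : 0 <= G t by rewrite /G.
have iG : mu.-integrable `[0, T] (EFin \o G) by exact: L1_cst.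
have GF (r t : R) : `]- d, d[%classic r -> `[0, T]%classic t ->
    `|partial1of2 F r t| <= G t.
  move=> /itvE rd; rewrite /= in_itv/= => t0T.
  by rewrite p1E// (le_trans (F'K _ _ rd t0T))// ler_norm.
apply: DeriveDef.
  exact: (derivable_under_integral _ sI iF dF1 G0 iG GF).
rewrite -derive1E /Int.
rewrite (differentiation_under_integral _ sI iF dF1 G0 iG GF)//.
apply: eq_Rintegral => t; rewrite inE/= in_itv/= => t0T.
by rewrite -p1E.
Qed.

Lemma is_derive_quad (A B C s : R) :
  is_derive s 1 (fun r => A + r * B + r ^+ 2 * C) (B + 2 * s * C).
Proof.
apply: is_derive_eq; rewrite /GRing.scale/=; ring.
Qed.

Section potential.
Variables (T A : R) (b c : R -> R) (phi phi1 phi2 : R -> R).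
Hypotheses (A0 : 0 < A) (bb : bmeas 0 T b) (bc : bmeas 0 T c).
Hypotheses (mphi : measurable_fun setT phi) (mphi1 : measurable_fun setT phi1).
Hypotheses (dphi : forall q : R, 0 < q -> is_derive q 1 phi (phi1 q))
  (dphi1 : forall q : R, 0 < q -> is_derive q 1 phi1 (phi2 q))
  (cphi2 : forall q : R, 0 < q -> {for q, continuous phi2}).

(** In the application A, b and c are |gamma|^2, the scalar product of gamma and xi, and |xi|^2, so
    that [q s] is the squared norm of gamma + s xi. *)
Let q s t := A + s * (2 * b t) + s ^+ 2 * c t.
Let q1 s t := 2 * b t + 2 * s * c t.

(** Since b and c are bounded, the perturbed loops stay in one annulus for all small s, uniformly in
    t; there phi and its derivatives are bounded. *)
Let near_q : exists2 d, 0 < d & forall s t, `|s| < d -> 0 <= t <= T ->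
  A / 2 <= q s t <= A / 2 * 3.
Proof.
have [_ [Mb bMb]] := bb; have [_ [Mc cMc]] := bc.
pose M := 2 * `|Mb| + `|Mc| + 1.
have M0 : 0 < M by rewrite /M ltr_wpDl// addr_ge0// mulr_ge0.
(* The bound |s| < 1 absorbs the quadratic term into a linear one, giving |q - A| <= |s| M; the
   other bound makes this at most A / 2. *)
exists (Num.min 1 (A / 2 / M)).
  by rewrite lt_min ltr01 !divr_gt0.
move=> s t; rewrite lt_min => /andP[s1 sM] t0T.
have : `|q s t - A| <= A / 2.
  rewrite /q (_ : _ - A = s * (2 * b t + s * c t)); last ring.
  rewrite normrM.
  apply: (@le_trans _ _ (`|s| * M)).
    apply: ler_wpM2l => //; apply: le_trans (ler_normD _ _) _.
    rewrite !normrM ger0_norm// /M -addrA lerD//.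
      by rewrite ler_wpM2l// (le_trans (bMb t t0T))// ler_norm.
    apply: (@le_trans _ _ `|Mc|); last by rewrite lerDl.
    rewrite -[leRHS]mul1r ler_pM//; first exact: ltW.
    by rewrite (le_trans (cMc t t0T))// ler_norm.
  by rewrite -ler_pdivlMr// ltW.
by rewrite ler_distl => /andP[? ?]; apply/andP; split; lra.
Qed.

Let bounded_pos (f : R -> R) : (forall q : R, 0 < q -> {for q, continuous f}) ->
  exists M, forall r, A / 2 <= r <= A / 2 * 3 -> `|f r| <= M.
Proof.
move=> cf; have : cont (A / 2) (A / 2 * 3) f.
  apply: continuous_in_subspaceT => r; rewrite inE/= in_itv/= => /andP[r0 _].
  by apply: cf; apply: lt_le_trans r0; rewrite divr_gt0.
by move=> /cont_bmeas[].
Qed.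

Let meas_q s : measurable_fun `[0, T] (q s).
Proof.
case: bb bc => mb _ [mc _]; rewrite /q.
apply: measurable_funD; last by apply: measurable_funM.
by apply: measurable_funD => //; apply: measurable_funM => //; apply: measurable_funM.
Qed.

Let cphi r : 0 < r -> {for r, continuous phi}.
Proof.
move=> /dphi/@ex_derive/derivable1_diffP; exact: differentiable_continuous.
Qed.

Let cphi1 r : 0 < r -> {for r, continuous phi1}.
Proof.
move=> /dphi1/@ex_derive/derivable1_diffP; exact: differentiable_continuous.
Qed.

(** The first derivative is given on a neighbourhood of 0 because it is differentiated again, the
    second only at 0. Positivity and boundedness are recorded for the computation of the action at
    nearby loops. *)
Lemma second_derivative_under_Int :
  (\forall s \near (0 : R), [/\ forall t, 0 <= t <= T -> 0 < q s t,
     bmeas 0 T (fun t => phi (q s t)) &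
     is_derive (s : R) 1 (fun r => Int 0 T (fun t => phi (q r t)))
       (Int 0 T (fun t => phi1 (q s t) * q1 s t))]) /\
  is_derive (0 : R) 1 (fun s => Int 0 T (fun t => phi1 (q s t) * q1 s t))
    (Int 0 T (fun t => phi2 A * (2 * b t) ^+ 2 + phi1 A * (2 * c t))).
Proof.
have [d d0 dq] := near_q.
have [[mb [Mb bMb]] [mc [Mc cMc]]] := (bb, bc).
have [M0 HM0] := bounded_pos cphi.
have [M1 HM1] := bounded_pos cphi1.
have [M2 HM2] := bounded_pos cphi2.
have q0 s t : `|s| < d -> 0 <= t <= T -> 0 < q s t.
  by move=> sd t0T; have /andP[+ _] := dq s t sd t0T; apply: lt_le_trans; rewrite divr_gt0.
have q1M s t : `|s| < d -> 0 <= t <= T -> `|q1 s t| <= 2 * Mb + 2 * d * Mc.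
  move=> sd t0T; apply: le_trans (ler_normD _ _) _; rewrite !normrM.
  rewrite (@ger0_norm _ 2)//; apply: lerD; first by rewrite ler_wpM2l// bMb.
  by rewrite ler_pM ?cMc// ler_wpM2l// ltW.
have bphi1 s : `|s| < d -> bmeas 0 T (fun t => phi1 (q s t)).
  move=> sd; split; first exact: measurableT_comp.
  by exists M1 => t t0T; apply: HM1; exact: dq.
have bq1 s : `|s| < d -> bmeas 0 T (q1 s).
  move=> sd; split; last by exists (2 * Mb + 2 * d * Mc) => t; exact: q1M.
  by apply: measurable_funD; apply: measurable_funM.
have dq1 (s t : R) : is_derive s 1 (q ^~ t) (q1 s t) by exact: is_derive_quad.
split.
  near=> s; have sd : `|s| < d.
    by near: s; have := @nbhs0_lt _ R^o _ d0.
  have bphi r : `|r| < d -> bmeas 0 T (fun t => phi (q r t)).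
    move=> rd; split; first exact: measurableT_comp.
    by exists M0 => t t0T; apply: HM0; exact: dq.
  split; [by move=> t; exact: q0|exact: bphi|].
  apply: (@is_derive_Int T d (M1 * (2 * Mb + 2 * d * Mc))
    (fun r t => phi (q r t)) (fun r t => phi1 (q r t) * q1 r t)) => //.
  - move=> r t rd t0T.
    exact: (@is_derive1_comp _ phi (q ^~ t) r _ _ (dphi (q0 r t rd t0T)) (dq1 r t)).
  - by move=> r t rd t0T; rewrite normrM ler_pM ?q1M// HM1// dq.
have -> : Int 0 T (fun t => phi2 A * (2 * b t) ^+ 2 + phi1 A * (2 * c t)) =
    Int 0 T (fun t => phi1 (q 0 t) * (2 * c t) + (phi2 (q 0 t) * q1 0 t) * q1 0 t).
  by apply: eq_Int => t _; rewrite /q /q1 !(mulr0, mul0r, expr0n, addr0)/=; ring.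
apply: (@is_derive_Int T d
  (M1 * (2 * Mc) + (M2 * (2 * Mb + 2 * d * Mc)) * (2 * Mb + 2 * d * Mc))
  (fun r t => phi1 (q r t) * q1 r t)
  (fun r t => phi1 (q r t) * (2 * c t) + (phi2 (q r t) * q1 r t) * q1 r t)) => //.
- by move=> r rd; apply: bmeasM; [exact: bphi1|exact: bq1].
- move=> r t rd t0T.
  have d1 : is_derive r 1 (fun s => phi1 (q s t)) (phi2 (q r t) * q1 r t).
    exact: (@is_derive1_comp _ phi1 (q ^~ t) r _ _ (dphi1 (q0 r t rd t0T)) (dq1 r t)).
  have d2 : is_derive r 1 (q1 ^~ t) (2 * c t).
    have := is_derive_quad (2 * b t) (2 * c t) 0 r.
    rewrite mulr0 addr0; congr is_derive; apply/funext => s; rewrite /q1; ring.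
  have := is_deriveM d1 d2; congr is_derive.
  by rewrite /GRing.scale/=; ring.
- move=> r t rd t0T; apply: le_trans (ler_normD _ _) _; rewrite !normrM.
  rewrite (@ger0_norm _ 2)//.
  apply: lerD; last first.
    by rewrite ler_pM ?mulr_ge0 ?q1M// ler_pM ?q1M// HM2// dq.
  by rewrite ler_pM ?mulr_ge0 ?HM1 ?dq// ler_wpM2l// cMc.
- by rewrite normr0.
Unshelve. all: by end_near. Qed.

End potential.
End SecondDerivative.

(** * The potential as a function of the squared distance, and the radius of the circle *)

Section Potential.
Context {R : realType}.
Implicit Types (mu alpha q r s t omega theta : R).

(* The potential as a function of the squared distance to the origin. *)
Definition pot mu alpha q : R :=
  if alpha == 0 then - (mu / 2) * ln q else mu * q `^ (- (alpha / 2)).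

(** Differentiating the power produces the factor alpha mu, which would vanish at alpha = 0; there
    the logarithm supplies mu instead. With this factor a single formula covers both cases from the
    first derivative on. *)
Definition pot_coef mu alpha : R := if alpha == 0 then mu else alpha * mu.

Definition pot1 mu alpha q : R :=
  - (pot_coef mu alpha / 2) * q `^ (- (alpha / 2) - 1).

Definition pot2 mu alpha q : R :=
  pot_coef mu alpha / 2 * (alpha / 2 + 1) * q `^ (- (alpha / 2) - 1 - 1).

Lemma potentialE mu alpha (p : R * R) : 0 < p.1 ^+ 2 + p.2 ^+ 2 ->
  potential mu alpha p = pot mu alpha (p.1 ^+ 2 + p.2 ^+ 2).
Proof.
move=> p0; rewrite /potential /pot /enorm -powR12_sqrt; last exact: ltW.
case: ifPn => _; first by rewrite ln_powR; field.
by rewrite -powRrM powRN; do 3 f_equal; field.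
Qed.

Lemma is_derive_pot mu alpha q : 0 < q ->
  is_derive q 1 (pot mu alpha) (pot1 mu alpha q).
Proof.
move=> q0; rewrite /pot /pot1 /pot_coef; case: eqP => [->|_].
  rewrite mul0r oppr0 sub0r powR_inv1 ?ltW//.
  exact: (is_deriveZ (- (mu / 2)) (is_derive1_ln q0)).
apply: is_derive_eq; first exact: (is_deriveZ mu (is_derive1_powR _ q0)).
by rewrite /GRing.scale/=; field.
Qed.

Lemma is_derive_pot1 mu alpha q : 0 < q ->
  is_derive q 1 (pot1 mu alpha) (pot2 mu alpha q).
Proof.
move=> q0; apply: is_derive_eq.
  exact: (is_deriveZ (- (pot_coef mu alpha / 2)) (is_derive1_powR _ q0)).
by rewrite /GRing.scale/= /pot2; field.
Qed.

Lemma continuous_pot2 mu alpha q : 0 < q -> {for q, continuous (pot2 mu alpha)}.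
Proof.
move=> q0; apply: differentiable_continuous; apply/derivable1_diffP.
by apply: derivableZ; have /@ex_derive := is_derive1_powR (- (alpha / 2) - 1 - 1) q0.
Qed.

Lemma measurable_pot mu alpha : measurable_fun setT (pot mu alpha).
Proof.
by rewrite /pot; case: eqP => _; apply: measurable_funM => //; exact: measurable_cst.
Qed.

Lemma measurable_pot1 mu alpha : measurable_fun setT (pot1 mu alpha).
Proof. by apply: measurable_funM => //; exact: measurable_powR. Qed.

(** By homogeneity of [pot1], the second derivative is determined by the first, so the value of
    [pot1] on the circle is all that the second variation needs to know about mu and the radius. *)
Lemma pot2E mu alpha q : 0 < q ->
  pot2 mu alpha q = - (alpha / 2 + 1) * pot1 mu alpha q / q.
Proof.
move=> q0; rewrite /pot2 /pot1 powRB; last by rewrite (gt_eqF q0) implybT.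
by rewrite powRr1 ?ltW//; field; rewrite gt_eqF.
Qed.

Lemma derive1_fst (f : R -> R * R) t : derivable f t 1 ->
  (derive1 f t).1 = derive1 (fst \o f) t.
Proof.
move=> df; apply/esym/cvg_lim; first exact: Rhausdorff.
have h : h^-1 *: (f (h + t) - f t) @[h --> 0^'] --> derive1 f t.
  move: df; rewrite /derivable /derive1 => df.
  rewrite (_ : (fun h => _) = (fun h => h^-1 *: ((f \o shift t) (h *: 1) - f t))).
    exact: df.
  by apply/funext => h /=; rewrite [h *: 1]mulr1.
have c1 : fst @ nbhs (derive1 f t) --> (derive1 f t).1 by exact: cvg_fst.
exact: (cvg_comp _ _ h c1).
Qed.

Lemma is_derive_cos_phase omega theta t :
  is_derive t 1 (fun t => cos (omega * t + theta)) (- (omega * sin (omega * t + theta))).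
Proof. by apply: is_derive_eq; rewrite /GRing.scale/=; ring. Qed.

Lemma is_derive_sin_phase omega theta t :
  is_derive t 1 (fun t => sin (omega * t + theta)) (omega * cos (omega * t + theta)).
Proof. by apply: is_derive_eq; rewrite /GRing.scale/=; ring. Qed.

(** This is Kepler's third law at angular speed 1. At the time [t0] of zero phase the circle passes
    through (r, 0), where the first component of the equation of motion reads - r = 2 r
    [pot1](r^2). *)
Lemma circular_radius mu alpha gamma r omega theta :
  0 < r -> `|omega| = 1 -> kepler_solution mu alpha gamma ->
  (forall t, gamma t =
    (r * cos (omega * t + theta), r * sin (omega * t + theta))) ->
  pot1 mu alpha (r ^+ 2) = - (1 / 2).
Proof.
move=> r0 omega1 kgamma gammaE.
have om2 : omega * omega = 1.
  by rewrite -expr2 -(real_normK (num_real _)) omega1 expr1n.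
pose t0 := - theta * omega.
have t0E : omega * t0 + theta = 0 by rewrite /t0 mulrCA om2; ring.
have d1 t : is_derive t 1 (fst \o gamma) (- (r * omega) * sin (omega * t + theta)).
  rewrite (_ : fst \o gamma = (fun t => r * cos (omega * t + theta))).
    by apply: is_derive_eq; rewrite /GRing.scale/=; ring.
  by apply/funext => s; rewrite /= gammaE.
have [_ dg ddg eqn] := kgamma t0.
have lhs : (derive1n 2 gamma t0).1 = - r.
  rewrite /derive1n/= derive1_fst//.
  rewrite (_ : fst \o _ = (fun t => - (r * omega) * sin (omega * t + theta))).
    rewrite derive1E.
    have /@derive_val -> := is_deriveZ (- (r * omega)) (is_derive_sin_phase omega theta t0).
    by rewrite t0E cos0 /GRing.scale/= mulr1 mulNr -mulrA om2 mulr1.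
  apply/funext => t /=; have [_ dgt _ _] := kgamma t.
  by rewrite derive1_fst// derive1E; have /@derive_val := d1 t.
have gt0 : gamma t0 = (r, 0) by rewrite gammaE t0E cos0 sin0 mulr1 mulr0.
have rhs : (grad (potential mu alpha) (gamma t0)).1 = pot1 mu alpha (r ^+ 2) * (2 * r).
  rewrite /grad/= gt0.
  pose g h := potential mu alpha (h + r, 0).
  have shiftE (h : R) : h *: ((1, 0) : R * R) + (r, 0) = (h + r, 0).
    by change ((h * 1 + r, h * 0 + 0) = (h + r, 0 : R)); rewrite mulr1 mulr0 addr0.
  have -> : 'D_((1, 0) : R * R) (potential mu alpha) (r, 0) = 'D_1 g 0.
    rewrite /derive (_ : (fun h => _) =
      (fun h : R => h^-1 *: ((g \o shift 0) (h *: 1) - g 0)))//.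
    apply/funext => h; rewrite /g /= [h *: 1]mulr1 shiftE.
    by rewrite addr0 add0r.
  rewrite (@near_eq_derive _ _ _ g (fun h => pot mu alpha ((h + r) ^+ 2))).
    have dq : is_derive (0 : R) 1 (fun h => (h + r) ^+ 2) (2 * r).
      by apply: is_derive_eq; rewrite /GRing.scale/=; ring.
    have q0 : 0 < (0 + r) ^+ 2 by rewrite add0r exprn_gt0.
    have /@derive_val -> := @is_derive1_comp _ (pot mu alpha) _ 0 _ _ (is_derive_pot mu alpha q0) dq.
    by rewrite add0r.
  near=> h; rewrite /g potentialE/= ?expr0n/= ?addr0// exprn_gt0//.
  have : `|h| < r by near: h; have := @nbhs0_lt _ R^o _ r0.
  by rewrite ltr_norml => /andP[? _]; lra.
have := congr1 fst eqn; rewrite lhs rhs => h.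
have : pot1 mu alpha (r ^+ 2) = - r / (2 * r) by rewrite h mulfK// gt_eqF// mulr_gt0.
by move=> ->; field; rewrite gt_eqF.
Unshelve. all: by end_near. Qed.

End Potential.

(** * The second variation at the circle, in fixed coordinates *)

Section SecondVariation.
Context {R : realType}.
Notation mu := (@lebesgue_measure R).
Implicit Types (m alpha r s t T omega theta : R) (gamma xi : R -> R * R).

Lemma is_wderivD T (x y g h : R -> R) (k : R) : is_wderiv T x g -> is_wderiv T y h ->
  is_wderiv T (fun t => x t + k * y t) (fun t => g t + k * h t).
Proof.
move=> /is_wderivP[lg pg] /is_wderivP[lh ph]; apply/is_wderivP; split.
  by apply: L2D => //; exact: L2Z.
by apply: primD => //; exact: primZ.
Qed.

Lemma C1_is_wderiv T (x g : R -> R) : (forall t, is_derive t 1 x (g t)) ->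
  continuous g -> is_wderiv T x g.
Proof.
move=> dx cg; have cg' : cont 0 T g by exact: continuous_cont.
apply/is_wderivP; split; first exact/bmeas_L2/cont_bmeas.
by apply: C1_prim.
Qed.

Lemma continuous_phase omega theta : continuous (fun t => omega * t + theta).
Proof.
move=> t; apply: cvgD; last exact: cvg_cst.
by apply: cvgM; [exact: cvg_cst|exact: cvg_id].
Qed.

Lemma continuous_cos_phase omega theta : continuous (fun t => cos (omega * t + theta)).
Proof.
move=> t; apply: continuous_comp; first exact: continuous_phase.
exact: continuous_cos.
Qed.

Lemma continuous_sin_phase omega theta : continuous (fun t => sin (omega * t + theta)).
Proof.
move=> t; apply: continuous_comp; first exact: continuous_phase.
exact: continuous_sin.
Qed.

Lemma actionE m alpha T gamma (g1 g2 q : R -> R) :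
  is_wderiv T (fst \o gamma) g1 -> is_wderiv T (snd \o gamma) g2 ->
  (forall t, 0 <= t <= T -> potential m alpha (gamma t) = q t) ->
  measurable_fun `[0, T] q ->
  action m alpha T gamma = Int 0 T (fun t => (g1 t ^+ 2 + g2 t ^+ 2) / 2 + q t).
Proof.
move=> w1 w2 potE mq.
have [wd1 ae1] := wderivP w1; have [wd2 ae2] := wderivP w2.
rewrite /action -/(Int 0 T _).
rewrite (@eq_Int _ _ _ _ (fun t => (wderiv T (fst \o gamma) t ^+ 2 +
    wderiv T (snd \o gamma) t ^+ 2) / 2 + q t)); last by move=> t /potE ->.
have mE (f1 f2 : R -> R) : measurable_fun `[0, T] f1 -> measurable_fun `[0, T] f2 ->
    measurable_fun `[0, T] (fun t => (f1 t ^+ 2 + f2 t ^+ 2) / 2 + q t).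
  move=> mf1 mf2; apply: measurable_funD => //; apply: measurable_funM => //.
  by apply: measurable_funD; apply: measurable_funX.
apply: ae_eq_Int.
- by case: wd1 => ? _ _; case: wd2 => ? _ _; exact: mE.
- by case: w1 => ? _ _; case: w2 => ? _ _; exact: mE.
- have FF := ae_filter_ringOfSetsType mu.
  apply: filterS2 ae1 ae2 => t e1 e2 t0T.
  by rewrite e1// e2.
Qed.

(** The kinetic energy is a quadratic polynomial in s. The potential contributes [pot2](r^2) (2 r
    u)^2 + 2 [pot1](r^2) |xi|^2, with u the radial component, and [pot2E] with [pot1](r^2) = -1/2
    turns this into (alpha + 2) u^2 - |xi|^2. *)
Lemma second_variationE m alpha r omega theta T gamma xi (g1 g2 : R -> R) :
  0 < r -> `|omega| = 1 ->
  (forall t, gamma t =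
    (r * cos (omega * t + theta), r * sin (omega * t + theta))) ->
  pot1 m alpha (r ^+ 2) = - (1 / 2) ->
  is_wderiv T (fst \o xi) g1 -> is_wderiv T (snd \o xi) g2 ->
  second_variation m alpha T gamma xi =
  Int 0 T (fun t => g1 t ^+ 2 + g2 t ^+ 2 + (alpha + 2) *
    (cos (omega * t + theta) * (xi t).1 + sin (omega * t + theta) * (xi t).2) ^+ 2
    - ((xi t).1 ^+ 2 + (xi t).2 ^+ 2)).
Proof.
move=> r0 omega1 gammaE pot1E w1 w2.
have [l1 p1] := (is_wderivP _ _ _).1 w1; have [l2 p2] := (is_wderivP _ _ _).1 w2.
pose G1 t := - (r * omega) * sin (omega * t + theta).
pose G2 t := r * omega * cos (omega * t + theta).
have wG1 : is_wderiv T (fst \o gamma) G1.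
  apply: C1_is_wderiv => [t|t].
    rewrite (_ : fst \o gamma = (fun t => r * cos (omega * t + theta))).
      by apply: is_derive_eq; rewrite /G1 /GRing.scale/=; ring.
    by apply/funext => s; rewrite /= gammaE.
  by apply: cvgM; [exact: cvg_cst|exact: continuous_sin_phase].
have wG2 : is_wderiv T (snd \o gamma) G2.
  apply: C1_is_wderiv => [t|t].
    rewrite (_ : snd \o gamma = (fun t => r * sin (omega * t + theta))).
      by apply: is_derive_eq; rewrite /G2 /GRing.scale/=; ring.
    by apply/funext => s; rewrite /= gammaE.
  by apply: cvgM; [exact: cvg_cst|exact: continuous_cos_phase].
have [lG1 _] := (is_wderivP _ _ _).1 wG1; have [lG2 _] := (is_wderivP _ _ _).1 wG2.
pose x t := (xi t).1; pose y t := (xi t).2.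
have bx : bmeas 0 T x by apply: cont_bmeas; exact: prim_cont p1.
have by_ : bmeas 0 T y by apply: cont_bmeas; exact: prim_cont p2.
pose C t := cos (omega * t + theta); pose S t := sin (omega * t + theta).
have bC : bmeas 0 T C by apply/cont_bmeas/continuous_cont/continuous_cos_phase.
have bS : bmeas 0 T S by apply/cont_bmeas/continuous_cont/continuous_sin_phase.
pose u t := C t * x t + S t * y t.
pose b t := r * u t.
pose c t := x t * x t + y t * y t.
have bu : bmeas 0 T u by apply: bmeasD; exact: bmeasM.
have bb : bmeas 0 T b by apply: bmeasM => //; exact: bmeas_cst.
have bc : bmeas 0 T c by apply: bmeasD; exact: bmeasM.
have r20 : 0 < r ^+ 2 by rewrite exprn_gt0.
have [near1 d2] := second_derivative_under_Int r20 bb bc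
  (measurable_pot m alpha) (measurable_pot1 m alpha)
  (fun q q0 => is_derive_pot m alpha q0) (fun q q0 => is_derive_pot1 m alpha q0)
  (fun q q0 => continuous_pot2 (q := q) q0).
pose q s t := r ^+ 2 + s * (2 * b t) + s ^+ 2 * c t.
pose q1 s t := 2 * b t + 2 * s * c t.
pose P s := Int 0 T (fun t => pot m alpha (q s t)).
pose P1 s := Int 0 T (fun t => pot1 m alpha (q s t) * q1 s t).
pose K0 := Int 0 T (fun t => (G1 t * G1 t + G2 t * G2 t) / 2).
pose K1 := Int 0 T (fun t => G1 t * g1 t + G2 t * g2 t).
pose K2 := Int 0 T (fun t => g1 t ^+ 2 + g2 t ^+ 2).
have LK1 : L1 0 T (fun t => G1 t * g1 t + G2 t * g2 t) by apply: L1D; exact: L2M.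
have LK2 : L1 0 T (fun t => g1 t ^+ 2 + g2 t ^+ 2) by apply: L1D; exact: L2_sqr.
have LK0 : L1 0 T (fun t => 2^-1 * (G1 t * G1 t + G2 t * G2 t)).
  by apply: L1Z; apply: L1D; exact: L2M.
pose f s := action m alpha T (fun t => gamma t + s *: xi t).
(* Only for small s is the perturbed loop known to avoid the origin, which [potentialE] requires. *)
have fE : \forall s \near (0 : R), f s = K0 + (s * K1 + s ^+ 2 * (K2 / 2)) + P s.
  near=> s.
  have [q0 bq _] : [/\ forall t, 0 <= t <= T -> 0 < q s t,
     bmeas 0 T (fun t => pot m alpha (q s t)) & is_derive (s : R) 1 P (P1 s)].
    by near: s; exact: near1.
  rewrite /f (@actionE _ _ _ _ (fun t => G1 t + s * g1 t) (fun t => G2 t + s * g2 t)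
    (fun t => pot m alpha (q s t))).
  - rewrite (@eq_Int _ _ _ _ (fun t => 2^-1 * (G1 t * G1 t + G2 t * G2 t)
        + (s * (G1 t * g1 t + G2 t * g2 t) + (s ^+ 2 / 2) * (g1 t ^+ 2 + g2 t ^+ 2))
        + pot m alpha (q s t))); last by move=> t _; field.
    have LL : L1 0 T (fun t => s * (G1 t * g1 t + G2 t * g2 t) +
        (s ^+ 2 / 2) * (g1 t ^+ 2 + g2 t ^+ 2)) by apply: L1D; exact: L1Z.
    rewrite IntD; [|exact: L1D|exact: bmeas_L1].
    rewrite IntD// IntD; [|exact: L1Z|exact: L1Z].
    rewrite (IntZ s)// (IntZ (s ^+ 2 / 2))// -/K1 -/K2 -/(P s).
    congr (_ + _ + _); first by apply: eq_Int => t _; rewrite mulrC.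
    by congr (_ + _); ring.
  - exact: (@is_wderivD T (fst \o gamma) (fst \o xi)).
  - exact: (@is_wderivD T (snd \o gamma) (snd \o xi)).
  - move=> t t0T.
    have qE : (gamma t + s *: xi t).1 ^+ 2 + (gamma t + s *: xi t).2 ^+ 2 = q s t.
      change ((((gamma t).1 + s * x t) ^+ 2 + ((gamma t).2 + s * y t) ^+ 2) = q s t).
      rewrite gammaE/= /q /b /u /c -/(C t) -/(S t).
      have cs : C t ^+ 2 + S t ^+ 2 = 1 by exact: cos2Dsin2.
      apply/eqP; rewrite -subr_eq0; apply/eqP.
      transitivity (r ^+ 2 * (C t ^+ 2 + S t ^+ 2 - 1)); first by ring.
      by rewrite cs subrr mulr0.
    by rewrite potentialE qE// q0.
  - by case: bq.
have f1E : \forall s \near (0 : R), derive1 f s = K1 + s * K2 + P1 s.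
  (* Differentiating [f] at a point s other than 0 requires the expansion on a neighbourhood of s;
     [nbhs_interior] provides it for all s near 0. *)
  have [near2 near3] := (nbhs_interior fE, near1).
  near=> s.
  have [_ _ dP] : [/\ forall t, 0 <= t <= T -> 0 < q s t,
     bmeas 0 T (fun t => pot m alpha (q s t)) & is_derive (s : R) 1 P (P1 s)].
    by near: s; exact: near3.
  rewrite derive1E.
  rewrite (@near_eq_derive _ _ _ f (fun s => K0 + s * K1 + s ^+ 2 * (K2 / 2) + P s)).
    have h := is_deriveD (is_derive_quad K0 K1 (K2 / 2) s) dP.
    have /@derive_val -> := h.
    by congr (_ + _); field.
  have : nbhs s (fun s => f s = K0 + (s * K1 + s ^+ 2 * (K2 / 2)) + P s).
    by near: s.
  by apply: filterS => z ->; rewrite addrA.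
rewrite /second_variation /derive1n/= -/f derive1E (near_eq_derive _ f1E).
have dq : is_derive (0 : R) 1 (fun s => K1 + s * K2) K2.
  by apply: is_derive_eq; rewrite /GRing.scale/= mulr0; ring.
have /@derive_val -> := is_deriveD dq d2.
rewrite /K2 -IntD//.
- apply: eq_Int => t _; rewrite pot2E// pot1E /b -/(x t) -/(y t) -/(C t) -/(S t) -/(u t) /c.
  by field; rewrite gt_eqF.
- apply: bmeas_L1; apply: bmeasD; apply: bmeasM; try exact: bmeas_cst.
    by apply: bmeasM; apply: bmeasM => //; exact: bmeas_cst.
  by apply: bmeasM => //; exact: bmeas_cst.
Unshelve. all: by end_near. Qed.

End SecondVariation.

(** * The second variation in radial and tangential components *)

Section RotatingFrame.
Context {R : realType}.
Implicit Types (m alpha r s t T omega theta : R) (gamma xi : R -> R * R).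

Lemma cosDperiod (a : R) n : cos (a + 2 * n%:R * pi) = cos a.
Proof.
rewrite -[RHS](periodicn (@cosD2pi R) n); congr (cos (_ + _)).
by rewrite -[RHS]mulr_natl -[in RHS]mulr_natl; ring.
Qed.

Lemma sinDperiod (a : R) n : sin (a + 2 * n%:R * pi) = sin a.
Proof.
rewrite -[RHS](periodicn (@sinD2pi R) n); congr (sin (_ + _)).
by rewrite -[RHS]mulr_natl -[in RHS]mulr_natl; ring.
Qed.

Lemma phase_period omega theta t n : `|omega| = 1 ->
  (cos (omega * (t + 2 * n%:R * pi) + theta) = cos (omega * t + theta)) *
  (sin (omega * (t + 2 * n%:R * pi) + theta) = sin (omega * t + theta)).
Proof.
move=> omega1; have [->|->] : omega = 1 \/ omega = -1.
  case: (lerP 0 omega) omega1 => h; first by left; rewrite -(ger0_norm h).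
  by move=> h1; right; rewrite -[LHS]opprK -(ltr0_norm h) h1.
  by rewrite !mul1r addrAC cosDperiod sinDperiod.
have e : -1 * t + theta = (-1 * (t + 2 * n%:R * pi) + theta) + 2 * n%:R * pi by ring.
by rewrite e cosDperiod sinDperiod.
Qed.

Lemma is_wderiv_mulC1 T (f f' x g : R -> R) :
  (forall t, is_derive t 1 f (f' t)) -> continuous f' -> is_wderiv T x g ->
  is_wderiv T (fun t => f t * x t) (fun t => f' t * x t + f t * g t).
Proof.
move=> df cf' /is_wderivP[lg pxg].
have [_ pf] := (is_wderivP _ _ _).1 (C1_is_wderiv T df cf').
apply/is_wderivP; split; last exact: primM.
apply: L2D; last by apply: L2_bmeasM => //; exact: cont_bmeas (prim_cont pf).
apply: bmeas_L2; apply: bmeasM; first exact/cont_bmeas/continuous_cont.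
exact: cont_bmeas (prim_cont pxg).
Qed.

Lemma eq_is_wderiv T (x g y h : R -> R) : x =1 y -> g =1 h ->
  is_wderiv T x g -> is_wderiv T y h.
Proof. by move=> /funext -> /funext ->. Qed.

Lemma is_wderiv_rot T omega theta (x g y h : R -> R) :
  is_wderiv T x g -> is_wderiv T y h ->
  is_wderiv T (fun t => cos (omega * t + theta) * x t + sin (omega * t + theta) * y t)
   (fun t => cos (omega * t + theta) * (g t + omega * y t) +
             sin (omega * t + theta) * (h t - omega * x t)).
Proof.
move=> wx wy.
have dC := is_derive_cos_phase omega theta; have dS := is_derive_sin_phase omega theta.
have cC := @continuous_cos_phase R omega theta.
have cS := @continuous_sin_phase R omega theta.
have h1 := is_wderiv_mulC1 dC _ wx; have h2 := is_wderiv_mulC1 dS _ wy.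
apply: eq_is_wderiv (is_wderivD 1 (h1 _) (h2 _)).
- by move=> t; rewrite mul1r.
- by move=> t /=; ring.
- by move=> t; apply: cvgN; apply: cvgM; [exact: cvg_cst|exact: cS].
- by move=> t; apply: cvgM; [exact: cvg_cst|exact: cC].
Qed.

Lemma is_wderiv_rot' T omega theta (x g y h : R -> R) :
  is_wderiv T x g -> is_wderiv T y h ->
  is_wderiv T (fun t => cos (omega * t + theta) * x t - sin (omega * t + theta) * y t)
   (fun t => cos (omega * t + theta) * (g t - omega * y t) -
             sin (omega * t + theta) * (h t + omega * x t)).
Proof.
move=> wx wy; have := is_wderiv_rot (- omega) (- theta) wx wy.
by apply: eq_is_wderiv => t; rewrite mulNr -opprD cosN sinN; ring.
Qed.

(* p and q stand for the derivatives of the radial and tangential components u and v;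
   v itself drops out by periodicity. *)
Definition rotating_form T alpha omega (u p q : R -> R) : R :=
  Int 0 T (fun t => p t ^+ 2 + (q t + 2 * omega * u t) ^+ 2 - (2 - alpha) * u t ^+ 2).

(** The centrifugal term omega^2 (u^2 + v^2) cancels - |xi|^2, and the rotation leaves the Coriolis
    term - 2 omega (p v - q u). As u v is periodic, p v + u q has integral 0, so the Coriolis term
    amounts to 4 omega u q; completing the square with q^2 gives the form. *)
Lemma second_variation_rotating m alpha r omega theta T gamma xi (u v p q : R -> R) :
  0 <= T -> 0 < r -> `|omega| = 1 ->
  (forall t, gamma t =
    (r * cos (omega * t + theta), r * sin (omega * t + theta))) ->
  pot1 m alpha (r ^+ 2) = - (1 / 2) ->
  (forall t, xi t = (cos (omega * t + theta) * u t - sin (omega * t + theta) * v t,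
    cos (omega * t + theta) * v t + sin (omega * t + theta) * u t)) ->
  is_wderiv T u p -> is_wderiv T v q -> u T = u 0 -> v T = v 0 ->
  second_variation m alpha T gamma xi = rotating_form T alpha omega u p q.
Proof.
move=> T0 r0 omega1 gammaE pot1E xiE wu wv uT vT.
have om2 : omega ^+ 2 = 1 by rewrite -(real_normK (num_real _)) omega1 expr1n.
have w1 : is_wderiv T (fst \o xi) (fun t => cos (omega * t + theta) * (p t - omega * v t)
    - sin (omega * t + theta) * (q t + omega * u t)).
  have := is_wderiv_rot' omega theta wu wv.
  by apply: eq_is_wderiv => // t; rewrite /= xiE.
have w2 : is_wderiv T (snd \o xi) (fun t => cos (omega * t + theta) * (q t + omega * u t)
    + sin (omega * t + theta) * (p t - omega * v t)).
  have := is_wderiv_rot omega theta wv wu.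
  by apply: eq_is_wderiv => // t; rewrite /= xiE.
rewrite (second_variationE r0 omega1 gammaE pot1E w1 w2).
have [lp pu] := (is_wderivP _ _ _).1 wu; have [lq pv] := (is_wderivP _ _ _).1 wv.
have bu := cont_bmeas (prim_cont pu); have bv := cont_bmeas (prim_cont pv).
have [Luv uvE] := primM pu pv.
have L : L1 0 T (fun t => p t ^+ 2 + (q t + 2 * omega * u t) ^+ 2 - (2 - alpha) * u t ^+ 2).
  apply: L1B.
    apply: L1D; first exact: L2_sqr.
    by apply: L2_sqr; apply: L2D => //; apply: L2Z; exact: bmeas_L2.
  by apply: L1Z; apply: L2_sqr; exact: bmeas_L2.
have : Int 0 T (fun t => p t * v t + u t * q t) = 0.
  have := uvE T; rewrite T0 lexx uT vT => /(_ isT).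
  by rewrite -[LHS]addr0 => /addrI.
move=> I0; rewrite /rotating_form.
transitivity (Int 0 T (fun t => (p t ^+ 2 + (q t + 2 * omega * u t) ^+ 2
     - (2 - alpha) * u t ^+ 2) - 2 * omega * (p t * v t + u t * q t))); last first.
  by rewrite IntB//; [rewrite IntZ// I0 mulr0 subr0|exact: L1Z].
apply: eq_Int => t _; rewrite xiE/=.
have cs := cos2Dsin2 (omega * t + theta).
set C := cos _ in cs *; set S := sin _ in cs *.
have C2 : C ^+ 2 = 1 - S ^+ 2 by rewrite -cs addrK.
have -> : C * (C * u t - S * v t) + S * (C * v t + S * u t) = (C ^+ 2 + S ^+ 2) * u t.
  ring.
have -> : (C * u t - S * v t) ^+ 2 + (C * v t + S * u t) ^+ 2 =
  (C ^+ 2 + S ^+ 2) * (u t ^+ 2 + v t ^+ 2) by ring.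
have -> : (C * (p t - omega * v t) - S * (q t + omega * u t)) ^+ 2 +
  (C * (q t + omega * u t) + S * (p t - omega * v t)) ^+ 2 =
  (C ^+ 2 + S ^+ 2) * (p t ^+ 2 + q t ^+ 2 + omega ^+ 2 * (u t ^+ 2 + v t ^+ 2)
    - 2 * omega * (p t * v t - q t * u t)) by ring.
rewrite cs !mul1r om2 sqrrD exprMn exprMn om2; ring.
Qed.

(* Since v is periodic, the mean of q + 2 omega u is 2 omega times that of u;
   this is what compensates for replacing u by u + c in the Wirtinger inequality. *)
Lemma rotating_form_ge0 T alpha omega c (u v p q : R -> R) :
  0 < T -> 0 <= alpha < 2 -> `|omega| = 1 ->
  is_wderiv T u p -> is_wderiv T v q -> v T = v 0 ->
  (2 - alpha) * Int 0 T (fun t => (u t + c) ^+ 2) <= Int 0 T (fun t => p t ^+ 2) ->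
  0 <= rotating_form T alpha omega u p q.
Proof.
move=> T0 /andP[a0 a2] omega1 wu wv vT wirt.
have om2 : omega ^+ 2 = 1 by rewrite -(real_normK (num_real _)) omega1 expr1n.
have [lp pu] := (is_wderivP _ _ _).1 wu; have [lq [_ vE]] := (is_wderivP _ _ _).1 wv.
have bu := cont_bmeas (prim_cont pu); have lu := bmeas_L2 bu.
have lw : L2 0 T (fun t => q t + 2 * omega * u t) by apply: L2D => //; exact: L2Z.
have Iq : Int 0 T q = 0.
  have := vE T; rewrite (ltW T0) lexx vT => /(_ isT).
  by rewrite -[LHS]addr0 => /addrI.
pose U := Int 0 T u.
have Iw : Int 0 T (fun t => q t + 2 * omega * u t) = 2 * omega * U.
  by rewrite IntD ?Iq ?add0r; [rewrite IntZ//; exact: L2_L1|exact: L2_L1|exact/L1Z/L2_L1].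
have := Int_cauchy (ltW T0) (L2_L1 lw) (L2_sqr lw).
rewrite Iw !exprMn om2 mulr1 subr0 => cauchy.
rewrite /rotating_form IntB; [|by apply: L1D; exact: L2_sqr|exact/L1Z/L2_sqr].
rewrite IntD; [|exact: L2_sqr|exact: L2_sqr].
rewrite IntZ; last exact: L2_sqr.
move: wirt.
have -> : Int 0 T (fun t => (u t + c) ^+ 2) =
    Int 0 T (fun t => u t ^+ 2) + 2 * c * U + c ^+ 2 * T.
  transitivity (Int 0 T (fun t => (u t ^+ 2 + 2 * c * u t) + c ^+ 2)).
    by apply: eq_Int => t _; ring.
  rewrite IntD; [|apply: L1D; [exact: L2_sqr|exact/L1Z/L2_L1]|exact: L1_cst].
  rewrite IntD; [|exact: L2_sqr|exact/L1Z/L2_L1].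
  by rewrite IntZ ?Int_cst ?subr0//; [exact: ltW|exact: L2_L1].
set P2 := Int 0 T (fun t => p t ^+ 2); set U2 := Int 0 T (fun t => u t ^+ 2).
set W2 := Int 0 T (fun t => (q t + _) ^+ 2) in cauchy *.
move=> wirt; rewrite -(pmulr_rge0 _ T0).
(* The effect of the shift by [c] on the Wirtinger bound, together with the Cauchy-Schwarz gain 4
   U^2, is a combination of squares with coefficients 2 - alpha and 2 + alpha. *)
have : 0 <= T * ((2 - alpha) * (2 * c * U + c ^+ 2 * T)) + 2 ^+ 2 * U ^+ 2.
  rewrite (_ : _ + _ = (2 - alpha) * (c * T + U) ^+ 2 + (2 + alpha) * U ^+ 2); last ring.
  by rewrite addr_ge0// mulr_ge0 ?sqr_ge0// ?subr_ge0 ?addr_ge0 ?(ltW a2).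
have : T * ((2 - alpha) * (U2 + 2 * c * U + c ^+ 2 * T)) <= T * P2 by rewrite ler_pM2l.
lra.
Qed.

End RotatingFrame.

(** * A Wirtinger inequality for functions with equally spaced zeros *)

Section Wirtinger.
Context {R : realType}.
Implicit Types (a b s t T lam theta tau h : R) (w g : R -> R).

(* Integrate (g + psi w)^2 >= 0 with psi = lam tan (lam t + theta), a solution of
   the Riccati equation psi' = lam^2 + psi^2. *)
Lemma wirtinger_segment lam theta a b w g : a <= b ->
  (forall t, a <= t <= b -> - (pi / 2) < lam * t + theta < pi / 2) ->
  prim a b w g -> L2 a b g ->
  lam ^+ 2 * Int a b (fun t => w t ^+ 2) <= Int a b (fun t => g t ^+ 2)
   + lam * (tan (lam * b + theta) * w b ^+ 2 - tan (lam * a + theta) * w a ^+ 2).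
Proof.
move=> ab range pw lg.
pose psi t := lam * tan (lam * t + theta).
pose psi' t := lam ^+ 2 + psi t * psi t.
have dpsi t : a <= t <= b -> is_derive t 1 psi (psi' t).
  move=> /range abt; have c0 : cos (lam * t + theta) != 0.
    by rewrite gt_eqF// cos_gt0_pihalf.
  apply: is_derive_eq; rewrite /GRing.scale/= cos2_tan2// /psi' /psi; ring.
have cpsi : cont a b psi.
  apply: derivable_within_continuous => t; rewrite in_itv/= => /dpsi.
  by move=> /@ex_derive.
have cpsi' : cont a b psi' by apply: contD; [exact: cont_cst|exact: contM].
have pp := primM (C1_prim dpsi cpsi') (primM pw pw).
have lw : L2 a b w by apply: bmeas_L2; exact: cont_bmeas (prim_cont pw).
have lpw : L2 a b (fun t => psi t * w t) by apply: L2_bmeasM => //; exact: cont_bmeas.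
have [lI IE] := pp.
have := IE b; rewrite ab lexx => /(_ isT) bdry.
have : 0 <= Int a b (fun t => (g t + psi t * w t) ^+ 2).
  by apply: Int_ge0 => t _; exact: sqr_ge0.
have -> : Int a b (fun t => (g t + psi t * w t) ^+ 2) =
  Int a b (fun t => (g t ^+ 2 - lam ^+ 2 * w t ^+ 2) +
    (psi' t * (w t * w t) + psi t * (g t * w t + w t * g t))).
  by apply: eq_Int => t _; rewrite /psi'; ring.
have lw2 := L1Z (lam ^+ 2) (L2_sqr lw).
rewrite IntD//; last by apply: L1B => //; exact: L2_sqr.
rewrite IntB//; last exact: L2_sqr.
rewrite IntZ; last exact: L2_sqr.
move: bdry; set J := Int a b (fun t => psi' t * _ + _) => bdry.
have -> : J = psi b * (w b * w b) - psi a * (w a * w a) by rewrite bdry; ring.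
rewrite /psi !expr2; lra.
Qed.

(** At the critical frequency the tangent blows up at the ends of an arc, so the inequality is first
    obtained for every smaller one; this lemma passes to the limit. *)
Lemma ler_limit_sqr (A B Lam : R) : 0 <= A -> 0 <= B -> 0 < Lam ->
  (forall lam, 0 < lam -> lam < Lam -> lam ^+ 2 * A <= B) -> Lam ^+ 2 * A <= B.
Proof.
move=> A0 B0 L0 H; rewrite leNgt; apply/negP => BA.
have [E EE] : exists E, E = Lam ^+ 2 * A by exists (Lam ^+ 2 * A).
have [D DEB] : exists D, D = E - B by exists (E - B).
rewrite -EE in BA.
have D0 : 0 < D by rewrite DEB subr_gt0.
have DE : D <= E by rewrite DEB lerBlDr lerDl.
have E0 : 0 < E by exact: lt_le_trans DE.
(* Lowering Lam by the factor 1 - e costs at most 2 e E = D / 2, half of the assumed gap [D]. *)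
pose e := D / (4 * E).
have e0 : 0 < e by rewrite divr_gt0// mulr_gt0.
have e1 : e <= 1 / 4 by rewrite /e ler_pdivrMr ?mulr_gt0//; lra.
have Ee : E * (2 * e) = D / 2 by rewrite /e; field; rewrite gt_eqF.
clearbody e.
have l0 : 0 < Lam * (1 - e) by rewrite mulr_gt0//; lra.
have lL : Lam * (1 - e) < Lam by rewrite gtr_pMr//; lra.
have := H _ l0 lL.
have -> : (Lam * (1 - e)) ^+ 2 * A = E - E * (2 * e) + E * e ^+ 2 by rewrite EE; ring.
have : 0 <= E * e ^+ 2 by rewrite mulr_ge0 ?sqr_ge0// ltW.
rewrite Ee; lra.
Qed.

(** On an arc between two consecutive zeros in [0, T] the boundary terms vanish with w. The
    remaining arc, which crosses the end of the period, is cut in two, and its boundary terms at 0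
    and T cancel by periodicity. *)
Lemma wirtinger_zeros T n tau w g :
  0 < T -> 0 <= tau <= T / n.+1%:R -> prim 0 T w g -> L2 0 T g -> w T = w 0 ->
  (forall j, (j < n.+1)%N -> w (tau + j%:R * (T / n.+1%:R)) = 0) ->
  (pi * n.+1%:R / T) ^+ 2 * Int 0 T (fun t => w t ^+ 2) <= Int 0 T (fun t => g t ^+ 2).
Proof.
move=> T0 /andP[tau0 tauh] pw lg wT w0.
have lw : L2 0 T w by apply: bmeas_L2; exact: cont_bmeas (prim_cont pw).
have [lw2 lg2] := (L2_sqr lw, L2_sqr lg).
have n0 : 0 < n.+1%:R :> R by rewrite ltr0n.
set h := T / n.+1%:R in tauh w0.
have h0 : 0 < h by rewrite divr_gt0.
have nh : n.+1%:R * h = T by rewrite /h mulrC divfK// gt_eqF.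
have p0 : 0 < pi :> R := pi_gt0 R.
apply: ler_limit_sqr.
- by apply: Int_ge0 => t _; exact: sqr_ge0.
- by apply: Int_ge0 => t _; exact: sqr_ge0.
- by rewrite divr_gt0// mulr_gt0.
move=> lam lam0 lamL.
have lh : lam * h < pi.
  by rewrite /h mulrA ltr_pdivrMr// -ltr_pdivlMr.
have mono x y : x <= y -> lam * x <= lam * y by move=> ?; rewrite ler_pM2l.
pose node j := tau + j%:R * h.
have node0 : node 0%N = tau by rewrite /node mul0r addr0.
have nodeS j : node j.+1 = node j + h by rewrite /node -natr1 mulrDl mul1r addrA.
have noden : node n.+1 = tau + T by rewrite /node nh.
have node_ge0 j : 0 <= node j by rewrite addr_ge0// mulr_ge0// ltW.
have node_le j : (j < n.+1)%N -> node j <= T.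
  move=> jn; rewrite -nh /node; have : j.+1%:R * h <= n.+1%:R * h.
    by rewrite ler_pM2r// ler_nat.
  rewrite -natr1 mulrDl mul1r; lra.
have w0' j : (j < n.+1)%N -> w (node j) = 0 by exact: w0.
have node_tau j : tau <= node j by rewrite lerDl mulr_ge0// ltW.
clearbody node h.
have sub2 f a b : L1 0 T f -> 0 <= a -> b <= T -> L1 a b f.
  by move=> lf a0 bT; exact: L1_sub lf.
have seg theta a b : 0 <= a -> a <= b -> b <= T ->
    - (pi / 2) < lam * a + theta -> lam * b + theta < pi / 2 ->
    lam ^+ 2 * Int a b (fun t => w t ^+ 2) <= Int a b (fun t => g t ^+ 2)
   + lam * (tan (lam * b + theta) * w b ^+ 2 - tan (lam * a + theta) * w a ^+ 2).
  move=> a0 ab bT la lb; apply: wirtinger_segment => //.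
  - move=> t /andP[at_ tb]; have := mono _ _ at_; have := mono _ _ tb => h1 h2.
    by apply/andP; split; lra.
  - exact: prim_sub pw.
  - case: lg => mg _; split; last exact: sub2.
    apply: measurable_funS mg => // t /=; rewrite !in_itv/= => /andP[at_ tb].
    by rewrite (le_trans a0)// (le_trans tb).
have middle j : (j < n.+1)%N -> lam ^+ 2 * Int tau (node j) (fun t => w t ^+ 2) <=
    Int tau (node j) (fun t => g t ^+ 2).
  elim: j => [_|j IHj jn]; first by rewrite node0 !Int_aa mulr0.
  have jn' := ltnW jn.
  have lej : node j <= node j.+1 by rewrite nodeS lerDl ltW.
  rewrite (@Int_chasles _ tau (node j))//; last by apply: sub2 => //; exact: node_le.
  rewrite (@Int_chasles _ tau (node j) _ (fun t => g t ^+ 2))//; last first.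
    by apply: sub2 => //; exact: node_le.
  rewrite mulrDr lerD ?IHj//.
  (* Centring the tangent at the midpoint of the arc keeps the phase within lam h / 2 < pi / 2. *)
  have := seg (- (lam * (node j + h / 2))) (node j) (node j.+1).
  rewrite (w0' j)// (w0' j.+1)// expr0n/= !mulr0 subrr mulr0 addr0; apply => //.
  - exact: node_le.
  - by rewrite mulrDr; lra.
  - by rewrite nodeS !mulrDr; lra.
have tauT : tau <= T by rewrite -node0 node_le.
(* The arc from [node n] to T + tau has midpoint T + tau - h / 2. Both of its pieces use the tangent
   centred there, shifted by T on [0, tau], so the two tangents agree at 0 and T. *)
have first_ := seg (- (lam * (tau - h / 2))) 0 tau (lexx _) tau0 tauT.
have nT : node n <= T by exact: node_le.
have last_ := seg (- (lam * (T + tau - h / 2))) (node n) T (node_ge0 n) nT (lexx _).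
have nodenE : node n = T + tau - h.
  by have := nodeS n; rewrite noden => e; lra.
rewrite (@Int_chasles _ 0 tau T)// (@Int_chasles _ tau (node n) T)//; last first.
  exact: sub2.
rewrite (@Int_chasles _ 0 tau T (fun t => g t ^+ 2))//.
rewrite (@Int_chasles _ tau (node n) T (fun t => g t ^+ 2))//; last exact: sub2.
have mid := middle n (ltnSn n).
move: first_ last_.
have -> : w tau = 0 by rewrite -node0 w0'.
have -> : w (node n) = 0 by rewrite w0'.
rewrite wT mulr0 expr0n/= !mulr0.
have -> : lam * T - lam * (T + tau - h / 2) = lam * 0 - lam * (tau - h / 2).
  by ring.
move: mid; set A1 := Int 0 tau _; set A2 := Int tau (node n) _; set A3 := Int (node n) T _.
set B1 := Int 0 tau _; set B2 := Int tau (node n) _; set B3 := Int (node n) T _.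
rewrite mulr0 !add0r !subr0 nodenE !mulrDr ?sub0r.
set X := tan _ * _.
clearbody A1 A2 A3 B1 B2 B3 X.
have lt0 : 0 <= lam * tau by rewrite mulr_ge0// ltW.
have lth : lam * tau <= lam * h := mono _ _ tauh.
move=> mid s1 s3.
have s1' := s1 ltac:(lra) ltac:(lra).
have s3' := s3 ltac:(lra) ltac:(lra).
lra.
Qed.

End Wirtinger.

(** * Common zeros of a combination of periodic functions *)

Section CyclicDeterminant.
Context {R : realType}.
Implicit Types (a b s t T tau h : R).

Lemma cont_shift a b c d (e : R) (f : R -> R) : cont a b f -> a <= c + e -> d + e <= b ->
  cont c d (fun t => f (t + e)).
Proof.
move=> /subspace_continuousP cf ace deb; apply/subspace_continuousP => x /=.
rewrite in_itv/= => /andP[cx xd].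
have abx : `[a, b]%classic (x + e) by rewrite /= in_itv/=; apply/andP; split; lra.
move=> P /(cf _ abx) /=; rewrite !nbhs_simpl/= => nP.
have : (t + e) @[t --> x] --> x + e by apply: cvgD; [exact: cvg_id|exact: cvg_cst].
move=> /(_ _ nP); rewrite /within/= nbhs_simpl/= => H.
apply: filterS H => t H /=; rewrite in_itv/= => /andP[ct td].
by apply: H; rewrite /= in_itv/=; apply/andP; split; lra.
Qed.

Lemma cont_sum I (r : seq I) (F : I -> R -> R) a b :
  (forall i, cont a b (F i)) -> cont a b (fun t => \sum_(i <- r) F i t).
Proof.
move=> cF; elim: r => [|i r IHr].
  by apply: eq_cont (@cont_cst R a b 0) => t _; rewrite big_nil.
by apply: eq_cont (contD (cF i) IHr) => t _; rewrite big_cons.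
Qed.

Lemma cont_prod I (r : seq I) (F : I -> R -> R) a b :
  (forall i, cont a b (F i)) -> cont a b (fun t => \prod_(i <- r) F i t).
Proof.
move=> cF; elim: r => [|i r IHr].
  by apply: eq_cont (@cont_cst R a b 1) => t _; rewrite big_nil.
by apply: eq_cont (contM (cF i) IHr) => t _; rewrite big_cons.
Qed.

Lemma cont_det n (A : R -> 'M[R]_n) a b :
  (forall i j, cont a b (fun t => A t i j)) -> cont a b (fun t => \det (A t)).
Proof.
move=> cA; apply: cont_sum => s; apply: contM; first exact: cont_cst.
by apply: cont_prod => i; exact: cA.
Qed.

(* Translating n + 1 equally spaced points of a circle by one step permutes them
   cyclically, an odd permutation when n is odd; hence the determinant of the values
   of n + 1 functions at these points changes sign, and vanishes at some translate. *)
Lemma common_zeros n T (f : 'I_n.+1 -> R -> R) : odd n -> 0 < T ->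
  (forall i, cont 0 T (f i)) -> (forall i, f i T = f i 0) ->
  exists tau, 0 <= tau <= T / n.+1%:R /\ exists v : 'I_n.+1 -> R,
    (exists i, v i != 0) /\
    forall j, (j < n.+1)%N -> \sum_i v i * f i (tau + j%:R * (T / n.+1%:R)) = 0.
Proof.
move=> oddn T0 cf fT; set h := T / _.
have n0 : 0 < n.+1%:R :> R by rewrite ltr0n.
have h0 : 0 < h by rewrite divr_gt0.
have nh : n.+1%:R * h = T by rewrite /h mulrC divfK// gt_eqF.
pose A tau : 'M[R]_n.+1 := \matrix_(i, j) f i (tau + j%:R * h).
have cA : cont 0 h (fun t => \det (A t)).
  apply: cont_det => i j.
  apply: (@eq_cont _ _ _ (fun t => f i (t + j%:R * h))) => [t _|]; first by rewrite mxE.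
  apply: cont_shift (cf i) _ _; first by rewrite add0r mulr_ge0// ltW.
  rewrite -nh -[X in X + _]mul1r -mulrDl addrC natr1.
  by rewrite ler_pM2r// ler_nat.
(* [lift_perm ord_max ord0 1] is the cycle j -> j + 1 sending the last index n to 0, and its parity
   is that of n. At the translate h the last point is T, where each function takes its value at
   0. *)
have Ah : A h = col_perm (lift_perm ord_max ord0 1%g) (A 0).
  apply/matrixP => i j; rewrite !mxE.
  case: (unliftP ord_max j) => [k|] ->.
    rewrite lift_perm_lift perm1 add0r; congr (f i _).
    by rewrite -[X in X + _]mul1r -mulrDl addrC natr1 lift_max lift0.
  rewrite lift_perm_id/= mul0r addr0 -(fT i); congr (f i _).
  by rewrite -nh -[X in X + _]mul1r -mulrDl addrC natr1.
have detAh : \det (A h) = - \det (A 0).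
  rewrite Ah col_permE det_mulmx det_perm odd_permV odd_lift_perm odd_perm1/=.
  by rewrite oddn expr1 mulrN1.
have [tau] : exists2 tau, tau \in `[0, h] & \det (A tau) = 0.
  apply: IVT => //; first exact: ltW.
  rewrite detAh minEle maxEle; case: ifPn => [|/negbTE]; move: (\det _) => D; last first.
    by move/negbT; rewrite -ltNge => ?; apply/andP; split; lra.
  by move=> ?; apply/andP; split; lra.
rewrite in_itv/= => tau0h /eqP/det0P[v v0 vA]; exists tau; split=> //.
exists (v 0); split.
  by have /rV0Pn[i] := v0; exists i.
move=> j jn; have := congr1 (fun B : 'rV[R]_n.+1 => B 0 (Ordinal jn)) vA.
rewrite !mxE => E; rewrite -[RHS]E.
by apply: eq_bigr => i _; rewrite mxE.
Qed.

End CyclicDeterminant.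

(** * The upper bound on the index *)

Section UpperBound.
Context {R : realType}.
Implicit Types (m alpha r s t T omega theta : R) (gamma xi : R -> R * R).

Lemma is_wderiv_sum T n (c : 'I_n -> R) (x g : 'I_n -> R -> R) :
  (forall i, is_wderiv T (x i) (g i)) ->
  is_wderiv T (fun t => \sum_i c i * x i t) (fun t => \sum_i c i * g i t).
Proof.
move=> wx; elim: (index_enum _) => [|i s IHs].
  apply: (@eq_is_wderiv _ _ (cst 0) (cst 0)) => [t|t|]; rewrite ?big_nil//.
  apply/is_wderivP; split; last exact: prim_cst.
  by apply: bmeas_L2; exact: bmeas_cst.
apply: eq_is_wderiv (is_wderivD (c i) IHs (wx i)) => t.
  by rewrite big_cons addrC.
by rewrite big_cons addrC.
Qed.

Lemma sum_pairE n (c : 'I_n -> R) (e : 'I_n -> R * R) :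
  \sum_i c i *: e i = (\sum_i c i * (e i).1, \sum_i c i * (e i).2).
Proof.
rewrite [LHS]surjective_pairing; congr (_, _).
- by rewrite (big_morph fst (id1 := 0) (op1 := +%R)).
- by rewrite (big_morph snd (id1 := 0) (op1 := +%R)).
Qed.

Definition rotating_field omega theta (u v : R -> R) : R -> R * R := fun t =>
  (cos (omega * t + theta) * u t - sin (omega * t + theta) * v t,
   cos (omega * t + theta) * v t + sin (omega * t + theta) * u t).

Lemma rotating_field_sum omega theta n (c : 'I_n -> R) (u v : 'I_n -> R -> R) :
  (fun t => \sum_i c i *: rotating_field omega theta (u i) (v i) t) =
  rotating_field omega theta (fun t => \sum_i c i * u i t) (fun t => \sum_i c i * v i t).
Proof.
apply/funext => t; rewrite sum_pairE /rotating_field/=; congr (_, _).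
- rewrite !mulr_sumr -sumrB; apply: eq_bigr => i _; ring.
- rewrite !mulr_sumr -big_split; apply: eq_bigr => i _ /=; ring.
Qed.

Lemma W12_rotating_field (k : nat) omega theta xi : `|omega| = 1 ->
  W12 (2 * k%:R * pi) xi -> exists u v p q,
  [/\ xi = rotating_field omega theta u v,
      is_wderiv (2 * k%:R * pi) u p, is_wderiv (2 * k%:R * pi) v q,
      u (2 * k%:R * pi) = u 0 & v (2 * k%:R * pi) = v 0].
Proof.
move=> omega1 [per [g1 w1] [g2 w2]].
have xiT : xi (2 * k%:R * pi) = xi 0 by rewrite -[in LHS](add0r (_ * pi)) per.
have [cT sT] := phase_period theta 0 k omega1; rewrite add0r in cT sT.
do 4 eexists; split; [|exact: (is_wderiv_rot omega theta w1 w2)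
  |exact: (is_wderiv_rot' omega theta w2 w1)|by rewrite /= cT sT xiT
  |by rewrite /= cT sT xiT].
apply/funext => t; rewrite /rotating_field/=.
have cs := cos2Dsin2 (omega * t + theta).
set C := cos _ in cs *; set S := sin _ in cs *.
rewrite [LHS]surjective_pairing; congr (_, _).
- by transitivity ((C ^+ 2 + S ^+ 2) * (xi t).1); [rewrite cs mul1r|ring].
- by transitivity ((C ^+ 2 + S ^+ 2) * (xi t).2); [rewrite cs mul1r|ring].
Qed.

(** Extending coefficients by 0 restricts Q to a coordinate subspace. This cuts a negative subspace
    that is too large down to dimension exactly 2M + 1, which the parity argument needs. *)
Lemma neg_def_dim_le T (Q : (R -> R * R) -> R) (n N : nat) : (n <= N)%N ->
  neg_def_dim T Q N -> neg_def_dim T Q n.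
Proof.
move=> nN [e [We free neg]].
pose ext (c : 'I_n -> R) (j : 'I_N) : R := oapp c 0 (insub (val j)).
have extE c i : ext c (widen_ord nN i) = c i.
  by rewrite /ext (_ : val (widen_ord nN i) = val i)// valK.
have sumE c t : \sum_(j < N) ext c j *: e j t = \sum_(i < n) c i *: e (widen_ord nN i) t.
  rewrite (bigID (fun j : 'I_N => (j < n)%N))/= [X in _ + X]big1; last first.
    by move=> j jn; rewrite /ext insubF ?scale0r//; exact: negbTE.
  rewrite addr0 (big_ord_narrow nN); apply: eq_bigr => i _.
  by rewrite extE.
exists (fun i => e (widen_ord nN i)); split => [i|c c0 i|c [i ci]]; first exact: We.
- rewrite -extE; apply: free => t; rewrite sumE; exact: c0.
- have := neg (ext c); rewrite (_ : (fun t => \sum_i ext c i *: e i t) =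
    (fun t => \sum_i c i *: e (widen_ord nN i) t)); last exact/funext/sumE.
  by apply; exists (widen_ord nN i); rewrite extE.
Qed.

Lemma neg_def_dim_upper m alpha r omega theta (k N M : nat) gamma :
  (0 < k)%N -> 0 <= alpha < 2 -> 0 < r -> `|omega| = 1 ->
  (forall t, gamma t =
    (r * cos (omega * t + theta), r * sin (omega * t + theta))) ->
  pot1 m alpha (r ^+ 2) = - (1 / 2) ->
  (2 - alpha) * k%:R ^+ 2 <= M.+1%:R ^+ 2 ->
  neg_def_dim (2 * k%:R * pi) (second_variation m alpha (2 * k%:R * pi) gamma) N ->
  (N <= M.*2)%N.
Proof.
move=> k0 a02 r0 omega1 gammaE pot1E aM nd; rewrite leqNgt; apply/negP => MN.
move: (neg_def_dim_le MN nd); set T := 2 * k%:R * pi => -[e [We _ neg]].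
have kR : 0 < k%:R :> R by rewrite ltr0n.
have p0 : 0 < pi :> R := pi_gt0 R.
have T0 : 0 < T by rewrite /T !mulr_gt0.
have := fun i => W12_rotating_field theta omega1 (We i).
move=> /choice[u] /choice[v] /choice[p] /choice[q] uvpq.
have eE i : e i = rotating_field omega theta (u i) (v i) by have [] := uvpq i.
have wu i : is_wderiv T (u i) (p i) by have [] := uvpq i.
have wv i : is_wderiv T (v i) (q i) by have [] := uvpq i.
have uT i : u i T = u i 0 by have [] := uvpq i.
have vT i : v i T = v i 0 by have [] := uvpq i.
(* Index 0 carries the constant 1, the others the radial components. *)
pose f (i : 'I_(M.*2.+2)) : R -> R := oapp u (cst 1) (unlift ord0 i).
have f0 : f ord0 = cst 1 by rewrite /f unlift_none.
have fS i : f (lift ord0 i) = u i by rewrite /f liftK.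
have cf i : cont 0 T (f i).
  case: (unliftP ord0 i) => [j|] ->; last by rewrite f0; exact: cont_cst.
  by rewrite fS; have [_ /prim_cont] := (is_wderivP _ _ _).1 (wu j).
have fT i : f i T = f i 0.
  by case: (unliftP ord0 i) => [j|] ->; rewrite ?f0// fS.
have oddM : odd M.*2.+1 by rewrite /= odd_double.
have [tau [tau0 [c [[i ci] zeros]]]] := common_zeros oddM T0 cf fT.
pose c0 := c ord0; pose d j := c (lift ord0 j).
have sumE t : \sum_i c i * f i t = (\sum_j d j * u j t) + 1 * c0.
  rewrite big_ord_recl f0 mulr1 mul1r addrC; congr (_ + _).
  by apply: eq_bigr => j _; rewrite fS.
(* Were all radial coefficients zero, the combination would be the constant [c0]; having a zero, it
   would vanish altogether. *)
have dneq0 : exists j, d j != 0.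
  apply: contrapT => /forallNP d0.
  have dz j : d j = 0 by apply/eqP/negbNE/negP => /d0.
  have := zeros 0%N isT; rewrite sumE big1 => [|j _]; last by rewrite dz mul0r.
  rewrite add0r mul1r => c00; move: ci.
  case: (unliftP ord0 i) => [j|] ->; first by rewrite -/(d j) dz eqxx.
  by rewrite -/c0 c00 eqxx.
have := neg d dneq0; apply/negP; rewrite -leNgt.
under eq_fun do under eq_bigr do rewrite eE.
rewrite rotating_field_sum.
have wU := is_wderiv_sum d wu; have wV := is_wderiv_sum d wv.
set U := fun t => \sum_i d i * u i t in wU *.
set V := fun t => \sum_i d i * v i t in wV *.
have UT : U T = U 0 by rewrite /U; apply: eq_bigr => j _; rewrite uT.
have VT : V T = V 0 by rewrite /V; apply: eq_bigr => j _; rewrite vT.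
rewrite (second_variation_rotating (ltW T0) r0 omega1 gammaE pot1E _ wU wV UT VT)//.
apply: (@rotating_form_ge0 _ _ _ _ c0 _ _ _ _ T0 a02 omega1 wU wV VT).
have [lP pU] := (is_wderivP _ _ _).1 wU.
have pW : prim 0 T (fun t => U t + c0) (fun t => \sum_i d i * p i t).
  apply: eq_prim (primD pU (prim_cst 0 T c0)) => t _ //=.
  by rewrite addr0.
apply: le_trans (wirtinger_zeros T0 tau0 pW lP _ _).
- apply: ler_wpM2r; first by apply: Int_ge0 => t _; exact: sqr_ge0.
  have -> : pi * M.*2.+2%:R / T = M.+1%:R / k%:R.
    rewrite -doubleS -muln2 natrM /T; move: (@pi R) p0 => P P0; field.
    by rewrite !gt_eqF.
  by rewrite expr_div_n ler_pdivlMr// exprn_gt0.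
- by rewrite UT.
- by move=> j jn; rewrite -(zeros j jn) sumE mul1r.
Qed.

End UpperBound.

(** * The lower bound: explicit negative modes *)

Section LowerBound.
Context {R : realType}.
Implicit Types (m alpha r s t T omega theta a b : R) (gamma xi : R -> R * R).

Lemma L1_sum n (F : 'I_n -> R -> R) a b : (forall i, L1 a b (F i)) ->
  L1 a b (fun t => \sum_i F i t).
Proof.
move=> lF; elim: (index_enum _) => [|i s IHs].
  by apply: L1_eq (@L1_cst R a b 0) => t _; rewrite big_nil.
by apply: L1_eq (L1D (lF i) IHs) => t _; rewrite big_cons.
Qed.

Lemma Int_sum n (F : 'I_n -> R -> R) a b : a <= b -> (forall i, L1 a b (F i)) ->
  Int a b (fun t => \sum_i F i t) = \sum_i Int a b (F i).
Proof.
move=> ab lF.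
have H (s : seq 'I_n) : L1 a b (fun t => \sum_(i <- s) F i t) /\
    Int a b (fun t => \sum_(i <- s) F i t) = \sum_(i <- s) Int a b (F i).
  elim: s => [|i s [ls IHs]].
    split; first by apply: L1_eq (@L1_cst R a b 0) => t _; rewrite big_nil.
    rewrite big_nil; transitivity (Int a b (fun=> 0)); last by rewrite Int_cst ?mul0r.
    by apply: eq_Int => t _; rewrite big_nil.
  split; first by apply: L1_eq (L1D (lF i) ls) => t _; rewrite big_cons.
  rewrite big_cons -IHs -IntD//; apply: eq_Int => t _; exact: big_cons.
by have [] := H (index_enum _).
Qed.

Lemma Int_sqr_sum_orthogonal n (f : 'I_n -> R -> R) (c d : 'I_n -> R) a b :
  a <= b -> (forall i, bmeas a b (f i)) ->
  (forall i j, Int a b (fun t => f i t * f j t) = if i == j then d i else 0) ->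
  Int a b (fun t => (\sum_i c i * f i t) ^+ 2) = \sum_i c i ^+ 2 * d i.
Proof.
move=> ab bf orth.
have lff i j : L1 a b (fun t => f i t * f j t) by apply: bmeas_L1; exact: bmeasM.
transitivity (Int a b (fun t => \sum_i \sum_j c i * c j * (f i t * f j t))).
  apply: eq_Int => t _; rewrite expr2 mulr_suml; apply: eq_bigr => i _.
  by rewrite mulr_sumr; apply: eq_bigr => j _; ring.
rewrite Int_sum//; last by move=> i; apply: L1_sum => j; exact: L1Z.
apply: eq_bigr => i _; rewrite Int_sum//; last by move=> j; exact: L1Z.
rewrite (bigD1 i)//= big1 ?addr0 => [|j ji].
  by rewrite IntZ// orth eqxx expr2.
by rewrite IntZ// orth eq_sym (negbTE ji) mulr0.
Qed.

Lemma Int_cos T a b : 0 <= T -> a != 0 -> sin (a * T + b) = sin b ->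
  Int 0 T (fun t => cos (a * t + b)) = 0.
Proof.
move=> T0 a0 per.
have d t : is_derive t 1 (fun t => a^-1 * sin (a * t + b)) (cos (a * t + b)).
  by apply: is_derive_eq; rewrite /GRing.scale/=; field.
have [] := C1_prim (fun t (_ : 0 <= t <= T) => d t)
  (continuous_cont (@continuous_cos_phase R a b)).
move=> _ /(_ T); rewrite T0 lexx => /(_ isT).
by rewrite mulr0 add0r per -[LHS]addr0 => /addrI <-.
Qed.

Section modes.
Variables (k : nat) (omega theta : R).
Hypotheses (k_gt0 : (0 < k)%N) (omega1 : `|omega| = 1).
Let T := 2 * k%:R * pi :> R.

Let kR : 0 < k%:R :> R. Proof. by rewrite ltr0n. Qed.

Let T_gt0 : 0 < T. Proof. by rewrite /T !mulr_gt0// pi_gt0. Qed.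

(* The 2M modes have the frequencies 1/k, ..., M/k, each occurring twice: the
   parity of the index selects the cosine or the sine. *)
Definition freq (i : nat) : R := (i./2.+1)%:R / k%:R.

Definition phase0 (i : nat) : R := - ((odd i)%:R * (pi / 2)).

Definition mode (i : nat) : R -> R := fun t => cos (freq i * t + phase0 i).

Definition mode' (i : nat) : R -> R := fun t => - freq i * sin (freq i * t + phase0 i).

(** The periodic primitive of - 2 omega [mode i], which makes the square in [rotating_form] vanish;
    it exists because the frequency is not 0. *)
Definition comode (i : nat) : R -> R :=
  fun t => - (2 * omega) / freq i * sin (freq i * t + phase0 i).

Definition comode' (i : nat) : R -> R := fun t => - (2 * omega) * mode i t.

Lemma freq_gt0 i : 0 < freq i.
Proof. by rewrite divr_gt0. Qed.

Lemma freqT i : freq i * T = 2 * (i./2.+1)%:R * pi.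
Proof.
rewrite /freq /T; move: (@pi R) => P; field.
by rewrite gt_eqF.
Qed.

Lemma freq_eq i j : freq i = freq j -> odd i = odd j -> i = j.
Proof.
move=> /(mulIf _) e o; rewrite -(odd_double_half i) -(odd_double_half j) o.
congr (_ + _.*2)%N; apply/succn_inj/eqP; rewrite -(eqr_nat R); apply/eqP; apply: e.
by rewrite invr_eq0 gt_eqF.
Qed.

Lemma sin_freqT i b : sin (freq i * T + b) = sin b.
Proof. by rewrite freqT addrC sinDperiod. Qed.

Lemma sin_freqDT i j b : sin ((freq i + freq j) * T + b) = sin b.
Proof. by rewrite mulrDl -addrA !sin_freqT. Qed.

Lemma sin_freqBT i j b : sin ((freq i - freq j) * T + b) = sin b.
Proof.
rewrite mulrBl -(sin_freqT j (_ + b)) [in LHS](_ : _ + _ = freq i * T + b).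
  exact: sin_freqT.
ring.
Qed.

Lemma Int_cos_sum i j :
  Int 0 T (fun t => cos ((freq i + freq j) * t + (phase0 i + phase0 j))) = 0.
Proof.
apply: Int_cos; [exact: ltW|by rewrite gt_eqF// addr_gt0 ?freq_gt0|exact: sin_freqDT].
Qed.

Lemma Int_cos_diff i j :
  Int 0 T (fun t => cos ((freq i - freq j) * t + (phase0 i - phase0 j))) =
  if i == j then T else 0.
Proof.
case: eqP => [->|ij].
  transitivity (Int 0 T (fun=> 1)).
    by apply: eq_Int => t _; rewrite !subrr mul0r addr0 cos0.
  by rewrite Int_cst ?ltW// subr0 mul1r.
have [fij|fij] := eqVneq (freq i) (freq j); last first.
  by apply: Int_cos; [exact: ltW|rewrite subr_eq0|exact: sin_freqBT].
(* Distinct modes of equal frequency are a cosine and a sine: their phases differ by pi / 2, up to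
   sign, and the integrand is identically 0. *)
have oij : odd i != odd j by apply/eqP => o; apply: ij; exact: freq_eq.
transitivity (Int 0 T (fun=> 0)); last by rewrite Int_cst ?mul0r// ltW.
apply: eq_Int => t _; rewrite fij subrr mul0r add0r /phase0.
case: (odd i) (odd j) oij => [] [] // _.
- by rewrite mul1r mul0r oppr0 subr0 cosN cos_pihalf.
- by rewrite mul1r mul0r opprK oppr0 add0r cos_pihalf.
Qed.

Let cont_cosphase a b : cont 0 T (fun t => cos (a * t + b)).
Proof. exact/continuous_cont/continuous_cos_phase. Qed.

Let L1cos a b : L1 0 T (fun t => cos (a * t + b)).
Proof. exact/bmeas_L1/cont_bmeas/cont_cosphase. Qed.

Lemma mode_orthogonal i j :
  Int 0 T (fun t => mode i t * mode j t) = if i == j then T / 2 else 0.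
Proof.
transitivity (Int 0 T (fun t =>
    2^-1 * (cos ((freq i - freq j) * t + (phase0 i - phase0 j)) +
    cos ((freq i + freq j) * t + (phase0 i + phase0 j))))).
  apply: eq_Int => t _; rewrite /mode.
  have -> : (freq i - freq j) * t + (phase0 i - phase0 j) =
    (freq i * t + phase0 i) - (freq j * t + phase0 j) by ring.
  have -> : (freq i + freq j) * t + (phase0 i + phase0 j) =
    (freq i * t + phase0 i) + (freq j * t + phase0 j) by ring.
  by move: (_ * t + phase0 i) (_ * t + phase0 j) => A B; rewrite cosB cosD; field.
rewrite IntZ; last by apply: L1D; exact: L1cos.
rewrite IntD; [|exact: L1cos|exact: L1cos].
rewrite Int_cos_diff Int_cos_sum addr0; case: ifP => _; first by rewrite mulrC.
by rewrite mulr0.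
Qed.

Lemma mode'_orthogonal i j :
  Int 0 T (fun t => mode' i t * mode' j t) = if i == j then freq i ^+ 2 * (T / 2) else 0.
Proof.
transitivity (Int 0 T (fun t => freq i * freq j *
    (2^-1 * (cos ((freq i - freq j) * t + (phase0 i - phase0 j)) -
    cos ((freq i + freq j) * t + (phase0 i + phase0 j)))))).
  apply: eq_Int => t _; rewrite /mode'.
  have -> : (freq i - freq j) * t + (phase0 i - phase0 j) =
    (freq i * t + phase0 i) - (freq j * t + phase0 j) by ring.
  have -> : (freq i + freq j) * t + (phase0 i + phase0 j) =
    (freq i * t + phase0 i) + (freq j * t + phase0 j) by ring.
  by move: (_ * t + phase0 i) (_ * t + phase0 j) => A B; rewrite cosB cosD; field.
have l : L1 0 T (fun t => cos ((freq i - freq j) * t + (phase0 i - phase0 j)) -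
    cos ((freq i + freq j) * t + (phase0 i + phase0 j))) by apply: L1B; exact: L1cos.
rewrite IntZ; last exact: L1Z.
rewrite IntZ// IntB; [|exact: L1cos|exact: L1cos].
rewrite Int_cos_diff Int_cos_sum subr0; case: eqP => [->|_]; last by rewrite !mulr0.
by rewrite expr2 [T / 2]mulrC.
Qed.

Lemma is_wderiv_mode i : is_wderiv T (mode i) (mode' i).
Proof.
apply: C1_is_wderiv => t.
  by apply: is_derive_eq; rewrite /mode' /GRing.scale/=; ring.
by apply: cvgM; [exact: cvg_cst|exact: continuous_sin_phase].
Qed.

Lemma is_wderiv_comode i : is_wderiv T (comode i) (comode' i).
Proof.
apply: C1_is_wderiv => t.
  apply: is_derive_eq; rewrite /comode' /mode /GRing.scale/=; field.
  by rewrite gt_eqF ?freq_gt0.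
by apply: cvgM; [exact: cvg_cst|exact: continuous_cos_phase].
Qed.

Lemma mode_period i t : (mode i (t + T) = mode i t) * (comode i (t + T) = comode i t).
Proof.
by rewrite /mode /comode mulrDr freqT addrAC cosDperiod sinDperiod.
Qed.

Lemma W12_mode i : W12 T (rotating_field omega theta (mode i) (comode i)).
Proof.
split.
- move=> t; rewrite /rotating_field !mode_period.
  by have [-> ->] := phase_period theta t k omega1.
- eexists; exact: (is_wderiv_rot' omega theta (is_wderiv_mode i) (is_wderiv_comode i)).
- eexists; exact: (is_wderiv_rot omega theta (is_wderiv_comode i) (is_wderiv_mode i)).
Qed.

(** With the square gone, the orthogonality of the modes and of their derivatives makes the form
    diagonal. *)
Lemma second_variation_modes m alpha r gamma n (c : 'I_n -> R) : 0 < r ->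
  (forall t, gamma t =
    (r * cos (omega * t + theta), r * sin (omega * t + theta))) ->
  pot1 m alpha (r ^+ 2) = - (1 / 2) ->
  second_variation m alpha T gamma
    (fun t => \sum_(i < n) c i *: rotating_field omega theta (mode i) (comode i) t) =
  T / 2 * \sum_(i < n) (freq i ^+ 2 - (2 - alpha)) * c i ^+ 2.
Proof.
move=> r0 gammaE pot1E.
have T0 := ltW T_gt0.
rewrite rotating_field_sum.
have wU := is_wderiv_sum c (fun i : 'I_n => is_wderiv_mode i).
have wV := is_wderiv_sum c (fun i : 'I_n => is_wderiv_comode i).
rewrite (second_variation_rotating T0 r0 omega1 gammaE pot1E _ wU wV)//; last 2 first.
- by apply: eq_bigr => i _; rewrite -[T]add0r mode_period.
- by apply: eq_bigr => i _; rewrite -[T]add0r mode_period.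
have [lP pU] := (is_wderivP _ _ _).1 wU.
transitivity (Int 0 T (fun t => (\sum_(i < n) c i * mode' i t) ^+ 2 -
    (2 - alpha) * (\sum_(i < n) c i * mode i t) ^+ 2)).
  apply: eq_Int => t _; congr (_ - _); rewrite [X in _ + X ^+ 2](_ : _ = 0).
    by rewrite expr0n addr0.
  rewrite mulr_sumr -big_split big1//= => i _; rewrite /comode'; ring.
have lU : L1 0 T (fun t => (\sum_(i < n) c i * mode i t) ^+ 2).
  by apply: L2_sqr; apply: bmeas_L2; exact: cont_bmeas (prim_cont pU).
rewrite IntB; [|exact: L2_sqr|exact: L1Z].
rewrite IntZ//.
rewrite (@Int_sqr_sum_orthogonal n (fun i => mode' i) _ (fun i => freq i ^+ 2 * (T / 2)))//.
- rewrite (@Int_sqr_sum_orthogonal n (fun i => mode i) _ (fun=> T / 2))//.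
  + rewrite !mulr_sumr -sumrB; apply: eq_bigr => i _; ring.
  + by move=> i; exact/cont_bmeas/cont_cosphase.
  + by move=> i j; exact: mode_orthogonal.
- move=> i; apply/cont_bmeas/contM; first exact: cont_cst.
  exact/continuous_cont/continuous_sin_phase.
- by move=> i j; exact: mode'_orthogonal.
Qed.

Lemma neg_def_dim_lower m alpha r gamma M : 0 < r ->
  (forall t, gamma t =
    (r * cos (omega * t + theta), r * sin (omega * t + theta))) ->
  pot1 m alpha (r ^+ 2) = - (1 / 2) ->
  (forall j, (0 < j <= M)%N -> j%:R ^+ 2 < (2 - alpha) * k%:R ^+ 2) ->
  neg_def_dim T (second_variation m alpha T gamma) M.*2.
Proof.
move=> r0 gammaE pot1E jM.
have Q := fun c : 'I_(M.*2) -> R => second_variation_modes c r0 gammaE pot1E.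
pose S (c : 'I_(M.*2) -> R) := \sum_(i < M.*2) (freq i ^+ 2 - (2 - alpha)) * c i ^+ 2.
have freqM (i : 'I_(M.*2)) : freq i ^+ 2 - (2 - alpha) < 0.
  rewrite subr_lt0 /freq expr_div_n ltr_pdivrMr ?exprn_gt0//; apply: jM.
  by rewrite /= ltn_half_double.
have S0 c : (exists i : 'I_(M.*2), c i != 0) -> S c < 0.
  move=> [i ci]; rewrite /S (bigD1 i)//= ltr_wnDr//.
    apply: sumr_le0 => j _; apply: mulr_le0_ge0; [exact: ltW|exact: sqr_ge0].
  by rewrite nmulr_rlt0// exprn_even_gt0.
exists (fun i : 'I_(M.*2) => rotating_field omega theta (mode i) (comode i)); split.
- by move=> i; exact: W12_mode.
(* Independence follows from definiteness: a combination vanishing as a function has the same second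
   variation as the zero combination, namely 0, whereas a nonzero coefficient would make it
   negative. *)
- move=> c c0 i; apply/eqP/negbNE/negP => ci.
  have := S0 c (ex_intro _ i ci).
  have : second_variation m alpha T gamma
      (fun t => \sum_(i < M.*2) c i *: rotating_field omega theta (mode i) (comode i) t) =
    second_variation m alpha T gamma
      (fun t => \sum_(i < M.*2) (0 : R) *: rotating_field omega theta (mode i) (comode i) t).
    congr (second_variation _ _ _ _ _); apply/funext => t; rewrite c0 big1// => j _.
    by rewrite scale0r.
  rewrite !Q [X in _ = _ * X]big1; last by move=> j _; rewrite expr0n mulr0.
  rewrite mulr0 -/(S c) => /eqP.
  by rewrite mulf_eq0 gt_eqF ?divr_gt0//= => /eqP ->; rewrite ltxx.
- by move=> c /S0; rewrite Q -/(S c) pmulr_rlt0// divr_gt0.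
Qed.

End modes.
End LowerBound.

(** * Counting the negative modes *)

Section Counting.
Context {R : realType}.
Implicit Types (X Y alpha : R).

Lemma exists_sqr_ge X : exists n : nat, X <= n.+1%:R ^+ 2.
Proof.
exists (Num.trunc X); apply: le_trans (ltW (truncnS_gt X)) _.
by rewrite -natrX ler_nat -[leqLHS]expn1 leq_pexp2l.
Qed.

(** The number of positive integers j with j^2 < X: they form an initial segment, whose length is
    the least n with X <= (n + 1)^2. *)
Definition count_sqr_lt X : nat := ex_minn (exists_sqr_ge X).

Lemma count_sqr_ltP X n : (n < count_sqr_lt X)%N = (n.+1%:R ^+ 2 < X).
Proof.
rewrite /count_sqr_lt; case: ex_minnP => N XN minN.
apply/idP/idP => [nN|nX].
  by rewrite ltNge; apply/negP => /minN; rewrite leqNgt nN.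
rewrite ltnNge; apply/negP => Nn; move: nX; rewrite ltNge; apply/negP/negPn.
by apply: le_trans XN _; rewrite -!natrX ler_nat leq_exp2r.
Qed.

Lemma count_sqr_lt_mono X Y : X <= Y -> (count_sqr_lt X <= count_sqr_lt Y)%N.
Proof.
move=> XY; rewrite leqNgt; apply/negP; rewrite count_sqr_ltP => h.
by have := lt_le_trans h XY; rewrite -count_sqr_ltP ltnn.
Qed.

Lemma count_sqr_lt_eq X n : n%:R ^+ 2 < X -> X <= n.+1%:R ^+ 2 -> count_sqr_lt X = n.
Proof.
move=> nX Xn; apply/eqP; rewrite eqn_leq; apply/andP; split.
  by rewrite leqNgt count_sqr_ltP -leNgt.
by case: n nX {Xn} => // n; rewrite -count_sqr_ltP.
Qed.

Definition circular_index (k : nat) alpha : nat :=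
  (count_sqr_lt ((2 - alpha) * k%:R ^+ 2)).*2.

(** The index can jump only where (2 - alpha) k^2 is a perfect square j^2, that is at [b j]. The
    subdivision lists these points by decreasing j, from the largest j with [b j] > 0 down to [b 0]
    = 2. *)
Lemma circular_index_piecewise (k : nat) : (0 < k)%N ->
  piecewise_constant 0 2 (circular_index k).
Proof.
move=> k0; have kR : 0 < k%:R ^+ 2 :> R by rewrite exprn_gt0// ltr0n.
pose N := count_sqr_lt (2 * k%:R ^+ 2).
pose b (j : nat) : R := 2 - j%:R ^+ 2 / k%:R ^+ 2.
pose s := [seq b (N - i)%N | i <- iota 0 N.+1].
have sE i : (i < N.+1)%N -> nth 0 s i = b (N - i)%N.
  by move=> iN; rewrite (nth_map 0%N) ?size_iota// nth_iota.
have szs : size s = N.+1 by rewrite size_map size_iota.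
clearbody s.
have bN0 : 0 < b N.
  rewrite /b subr_gt0 ltr_pdivrMr//.
  have [->|N0] := posnP N; first by rewrite expr0n/= mulr_gt0.
  by rewrite -(prednK N0) -count_sqr_ltP -/N prednK.
have bE j x : (b j < x) = ((2 - x) * k%:R ^+ 2 < j%:R ^+ 2).
  rewrite -ltr_pdivlMr// /b; apply/idP/idP; lra.
have bE' j x : (x < b j) = (j%:R ^+ 2 < (2 - x) * k%:R ^+ 2).
  rewrite -ltr_pdivrMr// /b; apply/idP/idP; lra.
exists s; split.
- apply/(pathP 0) => -[|i]; rewrite szs => iN.
    by rewrite sE//= subn0.
  rewrite /= !sE//; last exact: ltnW.
  rewrite bE' /b subKr divfK ?gt_eqF// -!natrX ltr_nat ltn_exp2r//.
  by rewrite ltn_sub2l.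
- rewrite -nth_last szs/=.
  by rewrite sE// subnn /b expr0n/= mul0r subr0.
- move=> i; rewrite szs => iN.
  suff H z : nth 0 (0 :: s) i < z < nth 0 s i -> circular_index k z = (N - i).*2%N.
    by move=> x y /H -> /H ->.
  rewrite sE// => /andP[lz]; rewrite bE' => zu.
  rewrite /circular_index (@count_sqr_lt_eq _ (N - i)%N)//.
  (* The first interval starts at 0 and not at a jump, so its upper bound comes from the choice of
     [N]; on the others it comes from the preceding jump. *)
  case: i iN lz {zu} => [_ /= z0|i iN].
    rewrite subn0; apply: (@le_trans _ _ (2 * k%:R ^+ 2)).
      by rewrite ler_pM2r//; lra.
    by rewrite leNgt -count_sqr_ltP ltnn.
  by rewrite /= sE ?(ltnW iN)// bE => /ltW; rewrite subnSK.
Qed.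

Lemma circular_index_cvg alpha : alpha < 2 ->
  circular_index k alpha @[k --> \oo] --> \oo.
Proof.
move=> a2; apply/cvgnyPge => A; have a0 : 0 < 2 - alpha by rewrite subr_gt0.
near=> k.
have hk : A.+1%:R ^+ 2 / (2 - alpha) < k%:R by near: k; exact: nbhs_infty_gtr.
have k1 : 1 <= k%:R :> R by rewrite ler1n; near: k; exact: nbhs_infty_gt.
apply: (@leq_trans (count_sqr_lt ((2 - alpha) * k%:R ^+ 2))).
  apply: ltnW; rewrite count_sqr_ltP mulrC -ltr_pdivrMr//; apply: lt_le_trans hk _.
  by rewrite expr2 ler_peMl// (le_trans ler01).
by rewrite /circular_index -addnn leq_addr.
Unshelve. all: by end_near. Qed.

End Counting.

Theorem mainTheorem5 (R : realType) (mu : R) (mu_gt0 : 0 < mu)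
    (gamma : R -> R -> R * R)
    (gamma_circ : forall alpha : R, 0 <= alpha < 2 ->
       circular_solution mu alpha (gamma alpha)) :
  exists iMorse : nat -> R -> nat,
    [/\ forall (k : nat) (alpha : R), (1 < k)%N -> 0 <= alpha < 2 ->
          is_morse_index mu alpha k (gamma alpha) (iMorse k alpha),
        forall k : nat, (1 < k)%N ->
          piecewise_constant 0 2 (iMorse k) /\
          (forall alpha beta : R, 0 <= alpha -> alpha <= beta -> beta < 2 ->
             (iMorse k beta <= iMorse k alpha)%N),
        forall k : nat, (1 < k)%N ->
          forall alpha : R, 2 - 1 / k%:R ^+ 2 < alpha < 2 ->
            iMorse k alpha = 0%N &
        forall alpha : R, 0 <= alpha < 2 ->
          iMorse k alpha @[k --> \oo] --> \oo].
Proof.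
exists circular_index; split.
- move=> k alpha /ltnW k0 a02.
  have [kep [r [omega [theta [r0 omega1 gammaE]]]]] := gamma_circ alpha a02.
  have pot1E := circular_radius r0 omega1 kep gammaE.
  split.
    apply: (neg_def_dim_lower k0 omega1 r0 gammaE pot1E) => -[//|j] /= jM.
    by rewrite -count_sqr_ltP.
  move=> m; apply: (neg_def_dim_upper k0 a02 r0 omega1 gammaE pot1E).
  by rewrite leNgt -count_sqr_ltP ltnn.
- move=> k /ltnW k0; split; first exact: circular_index_piecewise.
  move=> alpha beta _ ab _; rewrite /circular_index leq_double.
  by apply: count_sqr_lt_mono; rewrite ler_wpM2r ?sqr_ge0//; lra.
(* Here (2 - alpha) k^2 is at most 1, so that already j = 1 is excluded. *)
- move=> k /ltnW k0 alpha /andP[ak _]; apply/eqP; rewrite double_eq0 -leqn0 leqNgt.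
  rewrite count_sqr_ltP -leNgt expr1n -ler_pdivlMr ?exprn_gt0 ?ltr0n//.
  by lra.
- by move=> alpha /andP[_ a2]; exact: circular_index_cvg.
Qed.
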